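(* Let $f\in\Bbbk[c]$ with $f\notin\Bbbk$ and $f=cg$ for some $g\in\Bbbk[c]$, and let $P=P(f,g)$ with $u=d-a$. Let $p$ be an irreducible factor of $f$ and let $\theta\in P$. Define $G(f,p,\theta):=P[b;\sigma,\delta]$ by $\sigma(x)=p^{-1}xp$ and $\delta(x)=\theta x-\sigma(x)\theta$ for $x=a,u,c$. Then $G(f,p,\theta)$ is a Generalized Jordanian Matrix Algebra (GJMA) if and only if $\delta(u)=\tau(\delta(a))-\delta(a)$ and $\delta(c)=\tau(\delta(c))$.
   Context: $\Bbbk$ is an algebraically closed field of characteristic zero. A skew polynomial ring $R[x;\sigma,\delta]$ (with $\sigma$ an automorphism of $R$ and $\delta$ a $\Bbbk$-linear $\sigma$-derivation, $\delta(rs)=\sigma(r)\delta(s)+\delta(r)s$) has commutation rule $xr=\sigma(r)x+\delta(r)$. For $f,g\in\Bbbk[c]$, $P(f,g)$ is the $\Bbbk$-algebra on generators $a,c,d$ with relations $ac=ca+f$, $dc=cd+f$, $da=(a-g)d+ga$. Equivalently, with $u=d-a$, it is generated by $a,c,u$ with relations $ac=ca+f$, $uc=cu$, $au=ua+gu$. It has an involution (automorphism of order two) $\tau$ with $\tau(a)=d$, $\tau(d)=a$, $\tau(c)=c$ (so $\tau(u)=-u$). For a factor $p$ of $f$, $p^{-1}xp$ is computed in the localization of $P$ at the powers of $p$. $M_J(2)$ is the $\Bbbk$-algebra on generators $a,b,c,d$ with relations $ac=ca+c^2$, $bc=cb+ca+cd+c^2$, $dc=cd+c^2$, $bd=db+cb+cd-ad+d^2$,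 $da=ad-cd+ca$, $ba=ab+cb+cd-ad+a^2$. Two rings are birationally equivalent if their classical quotient rings are isomorphic (as $\Bbbk$-algebras). A skew polynomial ring $M=P(f,g)[b;\sigma,\delta]$ is a Generalized Jordanian Matrix Algebra (GJMA) if it is birationally equivalent to $M_J(2)$ and the involution $\tau$ of $P(f,g)$ extends to an automorphism of $M$ with $\tau(b)=b$. (It is known that $M_J(2)$ is birationally equivalent to $A_1(\Bbbk[s,t])$, the first Weyl algebra over $\Bbbk[s,t]$.) *)

(* Defs.v *)
From HB Require Import structures.
From mathcomp Require Import all_boot all_order all_algebra.
Set Implicit Arguments.
Unset Strict Implicit.
Unset Printing Implicit Defensive.
Import GRing.Theory.
Local Open Scope ring_scope.

(* Algebras given by generators and relations are specified by their
   universal property: the generators satisfy the relations, and any family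
   satisfying them in an algebra B is the image of the generators under a
   unique algebra morphism.  An element h(c) with h in k[c] is
   [horner_alg c h]. *)

Definition P_relations (k : fieldType) (f g : {poly k}) (A : algType k)
    (a c d : A) : Prop :=
  [/\ a * c = c * a + horner_alg c f,
      d * c = c * d + horner_alg c f
    & d * a = (a - horner_alg c g) * d + horner_alg c g * a].

Definition is_P (k : fieldType) (f g : {poly k}) (A : algType k)
    (a c d : A) : Prop :=
  [/\ P_relations f g a c d,
      forall (B : algType k) (a' c' d' : B), P_relations f g a' c' d' ->
        exists phi : {lrmorphism A -> B},
          [/\ phi a = a', phi c = c' & phi d = d']
    & forall (B : algType k) (phi psi : {lrmorphism A -> B}),
        phi a = psi a -> phi c = psi c -> phi d = psi d -> phi =1 psi].

Definition MJ2_relations (k : fieldType) (A : algType k)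
    (a b c d : A) : Prop :=
  [/\ a * c = c * a + c ^+ 2,
      b * c = c * b + c * a + c * d + c ^+ 2 &
  [/\ d * c = c * d + c ^+ 2,
      b * d = d * b + c * b + c * d - a * d + d ^+ 2,
      d * a = a * d - c * d + c * a
    & b * a = a * b + c * b + c * d - a * d + a ^+ 2]].

Definition is_MJ2 (k : fieldType) (A : algType k) (a b c d : A) : Prop :=
  [/\ MJ2_relations a b c d,
      forall (B : algType k) (a' b' c' d' : B), MJ2_relations a' b' c' d' ->
        exists phi : {lrmorphism A -> B},
          [/\ phi a = a', phi b = b', phi c = c' & phi d = d']
    & forall (B : algType k) (phi psi : {lrmorphism A -> B}),
        phi a = psi a -> phi b = psi b -> phi c = psi c -> phi d = psi d ->
        phi =1 psi].

(* Two-sided Ore localization A -> Q at S: the map inverts S, every element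
   of Q is both a right and a left fraction, and the kernel is the right,
   and also the left, S-torsion of A. *)
Definition Ore_localization (k : fieldType) (A : algType k) (S : A -> Prop)
    (Q : unitAlgType k) (l : {lrmorphism A -> Q}) : Prop :=
  [/\ forall s, S s -> l s \is a GRing.unit,
      forall q : Q, exists r s, S s /\ q = l r * (l s)^-1,
      forall q : Q, exists r s, S s /\ q = (l s)^-1 * l r,
      forall r, l r = 0 <-> exists2 s, S s & r * s = 0
    & forall r, l r = 0 <-> exists2 s, S s & s * r = 0].

Definition powers (k : fieldType) (A : algType k) (x : A) : A -> Prop :=
  fun s => exists n : nat, s = x ^+ n.

Definition regular (k : fieldType) (A : algType k) : A -> Prop :=
  fun s => GRing.lreg s /\ GRing.rreg s.

Definition classical_quotient_ring (k : fieldType) (A : algType k)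
    (Q : unitAlgType k) (l : {lrmorphism A -> Q}) : Prop :=
  Ore_localization (@regular k A) l.

Definition birationally_equivalent (k : fieldType) (A B : algType k) : Prop :=
  exists (QA QB : unitAlgType k)
         (lA : {lrmorphism A -> QA}) (lB : {lrmorphism B -> QB}),
    [/\ classical_quotient_ring lA, classical_quotient_ring lB
      & exists phi : {lrmorphism QA -> QB}, bijective phi].

(* M, with structure map j : R -> M and variable b, is R[b; sigma, delta].
   [(map_poly j q).[b]] is the sum of the j(q_i) b^i, coefficients on the
   left, so bijectivity says that M is left R-free on the powers of b. *)
Definition skew_polynomial_ring (k : fieldType) (R : algType k)
    (sigma : {lrmorphism R -> R}) (delta : {linear R -> R})
    (M : algType k) (j : {lrmorphism R -> M}) (b : M) : Prop :=
  [/\ bijective sigma,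
      forall r s, delta (r * s) = sigma r * delta s + delta r * s,
      forall r, b * j r = j (sigma r) * b + j (delta r)
    & bijective (fun q : {poly R} => (map_poly j q).[b])].

(* R stands for P(f,g), tau for its involution and MJ for M_J(2). *)
Definition GJMA (k : fieldType) (MJ R : algType k)
    (tau sigma : {lrmorphism R -> R}) (delta : {linear R -> R})
    (M : algType k) (j : {lrmorphism R -> M}) (b : M) : Prop :=
  [/\ skew_polynomial_ring sigma delta j b,
      birationally_equivalent M MJ
    & exists t : {lrmorphism M -> M},
        [/\ bijective t, forall x, t (j x) = j (tau x) & t b = b]].

(* Main.v *)
Require Import Defs.
From HB Require Import structures.
From mathcomp Require Import all_boot all_order all_algebra.
From mathcomp Require Import boolp generic_quotient ring.
Set Implicit Arguments.
Unset Strict Implicit.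
Unset Printing Implicit Defensive.
Import GRing.Theory.
Local Open Scope ring_scope.

(** Whether G is a GJMA splits into two independent questions.

    Extending tau. An endomorphism t of G = P[b; sigma, delta] with t = tau
    on P and t(b) = b must preserve b r = sigma(r) b + delta(r).  As G is
    left free on the powers of b, such a t exists exactly when tau commutes
    with sigma and with delta ([extension_commutes], [involution_extends]).
    It always commutes with sigma, which is conjugation by the tau-invariant
    element p(c).  Since tau and sigma commute, it commutes with delta as
    soon as it does so on the generators a, d and c; for a and d both
    equations say delta(u) = tau(delta(a)) - delta(a), because tau is an
    involution and d = a + u.

    Birational equivalence with M_J(2) holds for every p and theta.  In a
    ring of fractions put y = f^-1 a and s = c^-1 u.  The relations of
    P(f,g), with f = c g, become: s commutes with c and y, and
    y c = c y + 1.  Moreover t = p (b - theta) is central, as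
    b - theta induces sigma and sigma is conjugation by p.  So G embeds in
    W = k(c)[y; d/dc][s][t], an Ore localization of the Weyl algebra
    A_1(k[s,t]).  The algebra M_J(2) has the same shape, with f = c^2,
    g = p = c and t = c b - (a - c) d.  Both maps into W are injective because
    the monomials c^i a^j u^m b^n span the source, while their images are
    independent by a degree count in y, then s, then t ([faithful_span],
    [horner_span_faithful]).  Both images contain c, f y, c s and t for some
    nonzero f in k[c], so that every element of W acquires a
    denominator in k[c] on either side ([weyl_right_denominator],
    [weyl_left_denominator]); hence both algebras have for classical quotient
    ring the division algebra of fractions of W ([weyl_quotient_ring]).

    That division algebra is constructed here for an arbitrary Ore domain
    ([ofrac]).  W is obtained by three extensions R[X; D], each of which is
    again an Ore domain, by cancelling leading terms ([skew_ore]). *)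

(** * Skew polynomial rings R[X; D] of derivation type *)

Record derivation (k : fieldType) (R : algType k) := Derivation {
  der :> {linear R -> R};
  derM : forall r s, der (r * s) = r * der s + der r * s }.

(** A polynomial stands for the operator sum with coefficients on the left of
    the powers of X.  A separate name carries the ring structure in which
    X r = r X + D r. *)
Definition skewpoly (k : fieldType) (R : algType k) (D : derivation R) : Type :=
  {poly R}.

Section Skew.
Variables (k : fieldType) (R : algType k) (D : derivation R).
Local Notation S := (skewpoly D).
Implicit Types (p q : {poly R}) (r : R).

HB.instance Definition _ := GRing.Zmodule.copy S {poly R}.

Lemma der1 : D 1 = 0.
Proof.
by apply: (addIr (D 1)); rewrite add0r -{3}[1]mulr1 derM mul1r mulr1.
Qed.

(** Left multiplication by X. *)
Definition skewY p : {poly R} := p * 'X + map_poly D p.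

Lemma coef_skewY p i :
  (skewY p)`_i = (if i == 0 then 0 else p`_i.-1) + D p`_i.
Proof. by rewrite coefD coefMX coef_map. Qed.

Lemma skewY_zmod : zmod_morphism skewY.
Proof.
move=> p q; apply/polyP=> i; rewrite coefB !coef_skewY !coefB raddfB /=.
by case: eqP => _; rewrite ?subr0 ?add0r // opprD addrACA.
Qed.
HB.instance Definition _ :=
  GRing.isZmodMorphism.Build {poly R} {poly R} skewY skewY_zmod.

Lemma skewYZ r p : skewY (r *: p) = r *: skewY p + D r *: p.
Proof.
apply/polyP=> i; rewrite coef_skewY [RHS]coefD !coefZ coef_skewY derM mulrDr addrA.
by case: eqP => _; rewrite ?mulr0.
Qed.

Definition skewC r : S := r%:P.
Definition skewX : S := 'X.

Lemma iter_skewY_zmod i : zmod_morphism (iter i skewY).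
Proof. by move=> p q; elim: i => //= i ->; rewrite raddfB. Qed.
HB.instance Definition _ i := GRing.isZmodMorphism.Build {poly R} {poly R}
  (iter i skewY) (iter_skewY_zmod i).

Definition smul p q : {poly R} := \sum_(i < size p) p`_i *: iter i skewY q.

Lemma smulE n p q : (size p <= n)%N ->
  smul p q = \sum_(i < n) p`_i *: iter i skewY q.
Proof.
move=> le; rewrite /smul (big_ord_widen n (fun i => p`_i *: iter i skewY q)) //.
rewrite big_mkcond; apply: eq_bigr => i _; case: ltnP => // le'.
by rewrite nth_default // scale0r.
Qed.

Lemma smulBl p p' q : smul (p - p') q = smul p q - smul p' q.
Proof.
pose n := maxn (size p) (size p').
rewrite !(@smulE n) ?leq_maxl ?leq_maxr //; last first.
  by rewrite (leq_trans (size_polyD _ _)) // size_polyN.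
by rewrite -sumrB; apply: eq_bigr => i _; rewrite coefB scalerBl.
Qed.

Lemma smulBr p q q' : smul p (q - q') = smul p q - smul p q'.
Proof.
by rewrite /smul -sumrB; apply: eq_bigr => i _; rewrite raddfB scalerBr.
Qed.

(** A named function, so that additivity in the left argument can be a
    canonical instance. *)
Definition smulr q p := smul p q.
HB.instance Definition _ q := GRing.isZmodMorphism.Build {poly R} {poly R}
  (smulr q) (fun p p' => smulBl p p' q).
HB.instance Definition _ p := GRing.isZmodMorphism.Build {poly R} {poly R}
  (smul p) (smulBr p).

Lemma smulZ r p q : smul (r *: p) q = r *: smul p q.
Proof.
rewrite !(@smulE (size p)) ?size_scale_leq // scaler_sumr.
by apply: eq_bigr => i _; rewrite coefZ scalerA.
Qed.

Lemma size_skewY p : (size (skewY p) <= (size p).+1)%N.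
Proof.
apply/leq_sizeP => -[|i] // le; rewrite coef_skewY /= !nth_default ?raddf0 ?addr0 //.
exact: ltnW.
Qed.

Lemma skewY_sum n (F : nat -> R) p :
  skewY (\sum_(i < n) F i *: iter i skewY p) =
  \sum_(i < n) F i *: iter i.+1 skewY p + \sum_(i < n) D (F i) *: iter i skewY p.
Proof.
by rewrite raddf_sum -big_split; apply: eq_bigr => i _ /=; rewrite skewYZ.
Qed.

(** The case of associativity from which the general one follows. *)
Lemma smul_skewY p q : smul (skewY p) q = skewY (smul p q).
Proof.
rewrite (smulE _ (size_skewY p)) /smul skewY_sum.
under eq_bigr do rewrite coef_skewY scalerDl.
rewrite big_split /= big_ord_recl scale0r add0r; congr (_ + _).
by rewrite big_ord_recr /= nth_default // raddf0 scale0r addr0.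
Qed.

Lemma smulA : associative smul.
Proof.
move=> p q v.
rewrite -[RHS]/(smulr v (\sum_(i < size p) p`_i *: iter i skewY q)).
rewrite [RHS]raddf_sum.
transitivity (\sum_(i < size p) p`_i *: iter i skewY (smul q v)) => //.
apply: eq_bigr => i _ /=.
rewrite /smulr smulZ; congr (_ *: _); elim: (i : nat) => //= n ->.
by rewrite smul_skewY.
Qed.

Lemma smul_polyC r p : smul r%:P p = r *: p.
Proof.
by rewrite (@smulE 1) ?size_polyC_leq1 // big_ord1 coefC.
Qed.

Lemma iter_skewY1 i : iter i skewY 1 = 'X^i.
Proof.
have Db (b : bool) : D b%:R = 0 by case: b; rewrite ?der1 ?raddf0.
elim: i => //= i ->; apply/polyP=> j; rewrite coef_skewY !coefXn.
by rewrite Db addr0; case: j.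
Qed.

Lemma smulr1 p : smul p 1 = p.
Proof.
rewrite /smul; under eq_bigr do rewrite iter_skewY1.
rewrite -poly_def; apply/polyP => i; rewrite coef_poly.
by case: ltnP => // /(nth_default 0) ->.
Qed.

HB.instance Definition _ := GRing.Zmodule_isNzRing.Build S smulA
  (fun p => etrans (smul_polyC 1 p) (scale1r p)) smulr1
  (fun p q v => raddfD (smulr v) p q) (fun p => raddfD (smul p))
  (oner_neq0 {poly R}).

Lemma skewCM r s : skewC (r * s) = skewC r * skewC s.
Proof. by rewrite [RHS]smul_polyC -mul_polyC -polyCM. Qed.

Lemma skewC_zmod : zmod_morphism skewC. Proof. exact: raddfB. Qed.
HB.instance Definition _ := GRing.isZmodMorphism.Build R S skewC skewC_zmod.
HB.instance Definition _ := GRing.isMonoidMorphism.Build R S skewC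
  (erefl, skewCM).

Definition skew_scale (x : k) (p : S) : S := skewC (x%:A) * p.
Lemma skew_scaleA x y p : skew_scale x (skew_scale y p) = skew_scale (x * y) p.
Proof. by rewrite /skew_scale mulrA -rmorphM /= -scalerAl mul1r scalerA. Qed.
Lemma skew_scale1 : left_id 1 skew_scale.
Proof. by move=> p; rewrite /skew_scale scale1r rmorph1 mul1r. Qed.
Lemma skew_scaleDr : right_distributive skew_scale +%R.
Proof. by move=> x p q; rewrite /skew_scale mulrDr. Qed.
Lemma skew_scaleDl p : {morph skew_scale^~ p : x y / x + y}.
Proof. by move=> x y; rewrite /skew_scale scalerDl raddfD mulrDl. Qed.
HB.instance Definition _ := GRing.Zmodule_isLmodule.Build k S
  skew_scaleA skew_scale1 skew_scaleDr skew_scaleDl.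
Lemma skew_scaleAl (x : k) (p q : S) : x *: (p * q) = x *: p * q.
Proof. exact: mulrA. Qed.
HB.instance Definition _ := GRing.Lmodule_isLalgebra.Build k S skew_scaleAl.

Lemma skewXE (p : S) : skewX * p = skewY p.
Proof.
rewrite /skewX [LHS](@smulE 2) ?size_polyX // 2!big_ord_recl big_ord0 /=.
by rewrite !coefX /= scale0r add0r scale1r addr0.
Qed.

Lemma skewX_comm r : skewX * skewC r = skewC r * skewX + skewC (D r).
Proof.
rewrite skewXE [_ * skewX]smul_polyC -mul_polyC /skewY.
by rewrite map_polyC.
Qed.

Lemma skewXn i : (skewX ^+ i : S) = ('X^i : {poly R}).
Proof.
elim: i => // i IH; rewrite exprS skewXE -iter_skewY1 iterS iter_skewY1.
by congr skewY.
Qed.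

Lemma skewCE r p : skewC r * (p : S) = r *: p.
Proof. exact: smul_polyC. Qed.

Lemma skew_decomp (p : S) n : (size (p : {poly R}) <= n)%N ->
  p = \sum_(i < n) skewC (p : {poly R})`_i * skewX ^+ i.
Proof.
move=> le; under eq_bigr do rewrite skewCE skewXn.
rewrite -poly_def; apply/polyP => i; rewrite coef_poly.
by case: ltnP => // le'; rewrite nth_default // (leq_trans le).
Qed.

(** Constants from k are killed by D, hence commute with X. *)
Lemma skew_scalar_central (x : k) (p : S) :
  p * skewC x%:A = skewC x%:A * p.
Proof.
have XV : GRing.comm skewX (skewC x%:A).
  by rewrite /GRing.comm skewX_comm linearZ /= der1 scaler0 raddf0 addr0.
rewrite (@skew_decomp p _ (leqnn _)) mulr_suml mulr_sumr; apply: eq_bigr => i _.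
rewrite -mulrA -(commrX i (commr_sym XV)) !mulrA; congr (_ * _).
by rewrite -!rmorphM /= -scalerAr -scalerAl mulr1 mul1r.
Qed.
Lemma skew_scaleAr (x : k) (p q : S) : x *: (p * q) = p * (x *: q).
Proof. by rewrite [LHS]mulrA -skew_scalar_central -mulrA. Qed.
HB.instance Definition _ := GRing.Lalgebra_isAlgebra.Build k S skew_scaleAr.

Lemma skewC_scalable : scalable skewC.
Proof. by move=> a r; rewrite -mulr_algl skewCM. Qed.
HB.instance Definition _ :=
  GRing.isScalable.Build k R S *:%R skewC skewC_scalable.

Lemma skew_gen (G : S -> Prop) :
  (forall p q : S, G p -> G q -> G (p + q)) ->
  (forall p q : S, G p -> G q -> G (p * q)) ->
  (forall r, G (skewC r)) -> G skewX -> forall p : S, G p.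
Proof.
move=> GD GM GV GX p; rewrite (@skew_decomp p _ (leqnn _)).
elim/big_ind: _ => [|q r|i _]; [by rewrite -(raddf0 skewC) | exact: GD | ].
apply: (GM) => //; elim: (i : nat) => [|n IH]; first exact: (GV 1).
by rewrite exprS; apply: GM.
Qed.

(** Commuting X past a coefficient only creates terms of lower degree, so
    leading coefficients multiply as in the commutative case. *)
Lemma skew_deg_mul (p q : {poly R}) m n :
  (size p <= m.+1)%N -> (size q <= n.+1)%N ->
  (size (smul p q) <= (m + n).+1)%N /\ (smul p q)`_(m + n) = p`_m * q`_n.
Proof.
move=> le_p le_q.
have YP i : (size (iter i skewY q) <= (i + n).+1)%N /\
    (iter i skewY q)`_(i + n) = q`_n.
  elim: i => //= i [le E]; split; first exact: leq_trans (size_skewY _) _.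
  by rewrite addSn coef_skewY /= E (nth_default _ le) raddf0 addr0.
rewrite (smulE _ le_p); split.
  apply: (leq_trans (size_sum _ _ _)); apply/bigmax_leqP => i _.
  apply: leq_trans (size_scale_leq _ _) _; apply: leq_trans (YP i).1 _.
  by rewrite ltnS leq_add2r -ltnS.
rewrite coef_sum big_ord_recr /= coefZ (YP m).2 big1 ?add0r // => i _.
have le : (size (iter i skewY q) <= m + n)%N.
  by apply: leq_trans (YP i).1 _; rewrite -addSn leq_add2r.
by rewrite coefZ (nth_default _ le) mulr0.
Qed.

End Skew.

(** * Ore domains *)

Definition domain (R : nzRingType) :=
  forall x y : R, x != 0 -> y != 0 -> x * y != 0.

Definition right_ore (R : nzRingType) :=
  forall x y : R, x != 0 -> exists u v, u != 0 /\ y * u = x * v.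

(** The left Ore condition is the right one for the converse ring. *)
Definition ore_domain (R : nzRingType) :=
  [/\ domain R, right_ore R & right_ore R^c].

(** One step of division with a denominator allowed on the dividend is enough:
    a common right multiple of x and of y u - x v, with u nonzero, gives one
    of x and y.  The induction is on the sum of the sizes, and the roles of
    x and y are exchanged when y is the smaller one. *)
Lemma right_ore_of_division (R : nzRingType) (sz : R -> nat) : domain R ->
  (forall x y : R, x != 0 -> y != 0 -> (sz x <= sz y)%N ->
     exists u v, u != 0 /\ (sz (y * u - x * v)%R < sz y)%N) ->
  right_ore R.
Proof.
move=> dom step x y; have [n] := ubnP (sz x + sz y).
elim: n x y => // n IH x y lt_n x0.
have [->|y0] := eqVneq y 0; first by exists 1, 0; rewrite oner_neq0 mul0r mulr0.
have red (z w : R) : z != 0 -> w != 0 -> (sz z + sz w <= n)%N ->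
    (sz z <= sz w)%N -> exists u v, u != 0 /\ w * u = z * v.
  move=> z0 w0 le_n /step[] // u [v [u0 lt]].
  have [||u' [v' [u'0 E]]] := IH z (w * u - z * v) => //.
    by apply: leq_trans le_n; rewrite ltn_add2l.
  exists (u * u'), (v * u' + v'); split; first exact: dom.
  by rewrite mulrDr -E mulrBl !mulrA addrC subrK.
have [le|/ltnW le] := leqP (sz x) (sz y); first exact: red.
have [u [v [u0 E]]] : exists u v, u != 0 /\ x * u = y * v.
  by apply: red => //; rewrite addnC.
exists v, u; split=> //; apply: contraNneq (dom _ _ x0 u0) => v0.
by rewrite E v0 mulr0.
Qed.

Section SkewOre.
Variables (k : fieldType) (R : algType k) (D : derivation R).
Hypothesis oreR : ore_domain R.

Lemma skew_lead (p : skewpoly D) : p != 0 ->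
  exists n, size (p : {poly R}) = n.+1 /\ (p : {poly R})`_n != 0.
Proof.
move=> p0; exists (size (p : {poly R})).-1.
have szp : (0 < size (p : {poly R}))%N by rewrite size_poly_gt0.
by rewrite prednK //; split=> //; rewrite -[_`__]/(lead_coef _) lead_coef_eq0.
Qed.

Lemma skew_domain : domain (skewpoly D).
Proof.
have [dom _ _] := oreR.
move=> p q /skew_lead [m [Em pm]] /skew_lead [n [En qn]].
have [_ E] := @skew_deg_mul _ _ D p q m n (eq_leq Em) (eq_leq En).
apply: contraNneq (dom _ _ pm qn) => pq0.
by rewrite -E -[smul D p q]/((p : skewpoly D) * q) pq0 coef0.
Qed.

Lemma size_skew_cancel (p q : skewpoly D) n :
  (size (p : {poly R}) <= n.+1)%N -> (size (q : {poly R}) <= n.+1)%N ->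
  (p : {poly R})`_n = (q : {poly R})`_n ->
  (size ((p - q)%R : {poly R}) < n.+1)%N.
Proof.
move=> lep leq E; rewrite ltnS; apply/leq_sizeP => i; rewrite leq_eqVlt.
rewrite [_`_i]coefB => /orP[/eqP<-|lt]; first by rewrite E subrr.
by rewrite !nth_default ?subrr // (leq_trans _ lt).
Qed.

Lemma size_skewCXn (r : R) n :
  (size ((skewC D r * skewX D ^+ n)%R : {poly R}) <= n.+1)%N /\
  (skewC D r * skewX D ^+ n : {poly R})`_n = r.
Proof.
rewrite skewCE skewXn coefZ coefXn eqxx mulr1; split=> //.
by rewrite (leq_trans (size_scale_leq _ _)) ?size_polyXn.
Qed.

Lemma skewC_eq0 (r : R) : (skewC D r == 0) = (r == 0).
Proof. exact: polyC_eq0. Qed.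

(** The Ore condition of R supplies the multipliers that make two leading
    coefficients agree, and subtraction then lowers the degree. *)
Lemma skew_ore : ore_domain (skewpoly D).
Proof.
have [dom roreR loreR] := oreR; have domS := skew_domain.
pose sz (p : skewpoly D) := size (p : {poly R}).
split=> //; [apply: (@right_ore_of_division (skewpoly D) sz domS) |
  apply: (@right_ore_of_division (skewpoly D)^c sz)].
- rewrite /sz; move=> p q /skew_lead [m [Em pm]] /skew_lead [n [En _]].
  rewrite Em En ltnS => le.
  have [u [v [u0 E]]] := roreR _ (q : {poly R})`_n pm.
  exists (skewC D u), (skewC D v * skewX D ^+ (n - m)).
  rewrite skewC_eq0; split=> //; apply: size_skew_cancel.
  + have [] := @skew_deg_mul _ _ D q (skewC D u) n 0 (eq_leq En) (size_polyC_leq1 u).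
    by rewrite addn0.
  + have [szv _] := size_skewCXn v (n - m).
    by have [] := @skew_deg_mul _ _ D p _ m _ (eq_leq Em) szv; rewrite subnKC.
  + have [szv vE] := size_skewCXn v (n - m).
    have [_] := @skew_deg_mul _ _ D p _ m _ (eq_leq Em) szv.
    have [_] := @skew_deg_mul _ _ D q (skewC D u) n 0 (eq_leq En) (size_polyC_leq1 u).
    by rewrite addn0 subnKC // vE coefC /= E => -> ->.
- by move=> p q p0 q0; apply: domS.
- rewrite /sz; move=> p q /skew_lead [m [Em pm]] /skew_lead [n [En _]].
  rewrite Em En ltnS => le.
  have [u [v [u0 E]]] : exists u v : R,
      u != 0 /\ u * (q : {poly R})`_n = v * (p : {poly R})`_m.
    exact: (loreR _ (q : {poly R})`_n pm).
  exists (skewC D u), (skewC D v * skewX D ^+ (n - m)).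
  rewrite skewC_eq0; split=> //; apply: size_skew_cancel.
  + have [] := @skew_deg_mul _ _ D (skewC D u) q 0 n (size_polyC_leq1 u) (eq_leq En).
    by rewrite add0n.
  + have [szv _] := size_skewCXn v (n - m).
    by have [] := @skew_deg_mul _ _ D _ p _ m szv (eq_leq Em); rewrite subnK.
  + have [szv vE] := size_skewCXn v (n - m).
    have [_] := @skew_deg_mul _ _ D _ p _ m szv (eq_leq Em).
    have [_] := @skew_deg_mul _ _ D (skewC D u) q 0 n (size_polyC_leq1 u) (eq_leq En).
    by rewrite add0n subnK // vE coefC /= E => -> ->.
Qed.

(** An element of degree one is transcendental over R: the leading term of
    p (e X + e') cannot be cancelled by a constant.  The form matches one
    step of a Horner scheme. *)
Lemma skew_horner_free (p : skewpoly D) (e e' r : R) : e != 0 ->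
  p * (skewC D e * skewX D + skewC D e') + skewC D r = 0 -> p = 0 /\ r = 0.
Proof.
have [dom _ _] := oreR; set z := _ + skewC D e' => e0 E.
suff p0 : p = 0.
  by split=> //; apply/eqP; rewrite -skewC_eq0 -E p0 mul0r add0r.
apply/eqP; apply: contraT => /skew_lead [n [En pn]].
have [szz ze] : (size (z : {poly R}) <= 2)%N /\ (z : {poly R})`_1 = e.
  have [sze eE] := size_skewCXn e 1; rewrite expr1 in sze eE.
  split; last by rewrite coefD eE coefC addr0.
  by rewrite (leq_trans (size_polyD _ _)) // geq_max sze (leq_trans (size_polyC_leq1 _)).
have [_] := @skew_deg_mul _ _ D p z n 1 (eq_leq En) szz.
rewrite -[smul D p z]/(p * z) ze => Ec.
have := dom _ _ pn e0; rewrite -Ec; case/eqP.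
move/(congr1 (fun q : skewpoly D => (q : {poly R})`_(n + 1))): E.
by rewrite coef0 [LHS]coefD coefC addn1 addr0.
Qed.

End SkewOre.

(** R[X; 0] is the polynomial ring in a central variable. *)
Definition zero_derivation (k : fieldType) (R : algType k) : derivation R.
Proof.
exists (GRing.null_fun R : {linear R -> R}) => r s.
by rewrite mulr0 mul0r addr0.
Defined.

(** An interface that hides the representation by polynomials, so that the
    construction can be iterated over an abstract base. *)
Lemma skew_extension_exists (k : fieldType) (R : algType k) (D : derivation R) :
  ore_domain R ->
  exists (S : algType k) (V : {lrmorphism R -> S}) (X : S),
    [/\ ore_domain S,
        forall r, X * V r = V r * X + V (D r),
        forall G : S -> Prop,
          (forall p q, G p -> G q -> G (p + q)) ->
          (forall p q, G p -> G q -> G (p * q)) ->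
          (forall r, G (V r)) -> G X -> forall p, G p
      & forall (p : S) (e e' r : R), e != 0 ->
          p * (V e * X + V e') + V r = 0 -> p = 0 /\ r = 0].
Proof.
move=> oreR; exists (skewpoly D), (skewC D), (skewX D); split.
- exact: skew_ore.
- exact: skewX_comm.
- exact: skew_gen.
- exact: skew_horner_free.
Qed.

(** * The division algebra of fractions of an Ore domain *)

(** A fraction q is represented by the relation q x = y between elements x and
    y of R: the graph of left multiplication by q, on the right ideal of all
    denominators.  The last condition asks this domain to be as large as
    possible, which makes equal fractions equal as relations. *)
Definition right_graph (R : nzRingType) (q : R -> R -> Prop) : Prop :=
  [/\ forall x y x' y', q x y -> q x' y' -> q (x - x') (y - y'),
      forall x y w, q x y -> q (x * w) (y * w),
      forall y, q 0 y -> y = 0,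
      exists x y, x != 0 /\ q x y
    & forall x y w, w != 0 -> q (x * w) (y * w) -> q x y].

(** The Ore hypothesis is a parameter of the type, so that the ring structure,
    whose laws rest on it, can be found by unification. *)
Record ofrac (k : fieldType) (R : algType k) (oreR : ore_domain R) := OFrac {
  ofrac_graph :> R -> R -> Prop;
  ofracP : right_graph ofrac_graph }.

Section OreFractions.
Variables (k : fieldType) (R : algType k) (oreR : ore_domain R).
Local Notation Q := (ofrac oreR).
Implicit Types (x y z w : R) (q : Q).

HB.instance Definition _ := gen_eqMixin Q.
HB.instance Definition _ := gen_choiceMixin Q.

Let domR : domain R. Proof. by have [] := oreR. Qed.
Let roreR : right_ore R. Proof. by have [] := oreR. Qed.

Lemma domain_eq0 x y : x != 0 -> x * y = 0 -> y = 0.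
Proof. by move=> x0 xy0; apply/eqP; apply: contra_eqT xy0; apply: domR. Qed.

Lemma domain_cancelr x y w : w != 0 -> x * w = y * w -> x = y.
Proof.
move=> w0 E; apply/subr0_eq/eqP.
have: (x - y) * w = 0 by rewrite mulrBl E subrr.
by apply: contra_eqT => xy0; apply: domR.
Qed.

Lemma ofracB q x y x' y' : q x y -> q x' y' -> q (x - x') (y - y').
Proof. by case: (ofracP q) => H _ _ _ _; apply: H. Qed.
Lemma ofracM q x y w : q x y -> q (x * w) (y * w).
Proof. by case: (ofracP q) => _ H _ _ _; apply: H. Qed.
Lemma ofrac0 q y : q 0 y -> y = 0.
Proof. by case: (ofracP q) => _ _ H _ _; apply: H. Qed.
Lemma ofrac_ex q : exists x y, x != 0 /\ q x y.
Proof. by case: (ofracP q) => _ _ _ H _; apply: H. Qed.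
Lemma ofrac_sat q x y w : w != 0 -> q (x * w) (y * w) -> q x y.
Proof. by case: (ofracP q) => _ _ _ _ H; apply: H. Qed.
Lemma ofrac_fun q x y y' : q x y -> q x y' -> y = y'.
Proof.
by move=> qy /(ofracB qy); rewrite subrr => /ofrac0 /subr0_eq.
Qed.
Lemma ofrac00 q : q 0 0.
Proof.
by have [x [y [_ h]]] := ofrac_ex q; have := ofracB h h; rewrite !subrr.
Qed.

Lemma ofrac_dom q x : exists w y, w != 0 /\ q (x * w) y.
Proof.
have [x0 [y0 [nz q0]]] := ofrac_ex q; have [w [v [w0 E]]] := roreR x nz.
by exists w, (y0 * v); rewrite E; split=> //; apply: ofracM.
Qed.

Lemma ofrac_common q q' : exists x y y', [/\ x != 0, q x y & q' x y'].
Proof.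
have [x [y [x0 qx]]] := ofrac_ex q; have [w [z [w0 qz]]] := ofrac_dom q' x.
by exists (x * w), (y * w), z; split=> //; [apply: domR | apply: ofracM].
Qed.

(** Two fractions that agree at one nonzero denominator are equal: any other
    denominator has a nonzero multiple in common with it, and maximality of
    the domains does the rest.  Every ring law below reduces to exhibiting one
    denominator at which both sides are defined. *)
Lemma ofrac_eq q q' x y : x != 0 -> q x y -> q' x y -> q = q'.
Proof.
have sub (q1 q2 : Q) : x != 0 -> q1 x y -> q2 x y -> forall x' y', q1 x' y' -> q2 x' y'.
  move=> x0 h1 h2 x' y' h; have [w [v [w0 E]]] := roreR x' x0.
  apply: (ofrac_sat w0); have := ofracM w h; rewrite E => h'.
  by rewrite (ofrac_fun h' (ofracM v h1)); apply: ofracM.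
move=> x0 h h'.
have E : ofrac_graph q = ofrac_graph q'.
  by apply/funext => x'; apply/funext => y'; apply/propext; split; apply: sub.
case: q q' E {h h'} => [q qP] [q' q'P] /= E; case: _ / E in q'P *.
by rewrite (Prop_irrelevance qP q'P).
Qed.

(** The graph of y x^-1. *)
Definition ograph y x : R -> R -> Prop := fun x1 y1 =>
  exists w w1, [/\ w1 != 0, x1 * w1 = x * w & y1 * w1 = y * w].

Lemma ographP y x : x != 0 -> right_graph (ograph y x).
Proof.
move=> x0; split.
- move=> x1 y1 x2 y2 [w [w1 [nz1 Ex Ey]]] [v [v1 [nz2 Ex2 Ey2]]].
  have [s [t [s0 E]]] := roreR w1 nz2.
  exists (w * s - v * t), (w1 * s); split; first exact: domR.
    by rewrite mulrBl mulrBr !mulrA Ex -Ex2 -!mulrA E.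
  by rewrite mulrBl mulrBr !mulrA Ey -Ey2 -!mulrA E.
- move=> x1 y1 w [v [v1 [nz Ex Ey]]].
  have [s [t [s0 E]]] := roreR w nz.
  by exists (v * t), s; rewrite !mulrA -Ex -Ey -!mulrA E.
- move=> y1 [w [w1 [nz]]]; rewrite mul0r => /esym /(domain_eq0 x0) ->.
  by rewrite mulr0 => E; apply: (domain_cancelr nz); rewrite E mul0r.
- by exists x, y; split=> //; exists 1, 1; rewrite oner_neq0 !mulr1.
- move=> x1 y1 w w0 [v [v1 [nz Ex Ey]]].
  by exists v, (w * v1); rewrite !mulrA; split=> //; apply: domR.
Qed.

(** The fraction generated by a relation P that is functional and stable under
    right multiplication, as [ofrac_ofP] shows.  It is built from an
    arbitrary pair related by P; the second branch only makes it total. *)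
Definition ofrac_of (P : R -> R -> Prop) : Q :=
  match pselect (exists xy : R * R, xy.1 != 0 /\ P xy.1 xy.2) with
  | left h => OFrac oreR (ographP (projT1 (cid h)).2 (projT2 (cid h)).1)
  | right _ => OFrac oreR (ographP 0 (oner_neq0 R))
  end.

Lemma ofrac_ofP (P : R -> R -> Prop) x y :
  (exists x y, x != 0 /\ P x y) ->
  (forall x y w, P x y -> P (x * w) (y * w)) ->
  (forall x y y', P x y -> P x y' -> y = y') ->
  P x y -> ofrac_of P x y.
Proof.
move=> [x0 [y0 [x00 P0]]] PM Pf Pxy; rewrite /ofrac_of; case: pselect => [h|[]].
  case: (cid h) => -[x1 y1] /= [nz1 P1].
  have [w [v [w0 E]]] := roreR x nz1; exists v, w; split=> //.
  by apply: Pf (PM _ _ w Pxy) _; rewrite E; apply: PM.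
by exists (x0, y0).
Qed.

Definition ofrac_in (r : R) : Q := ofrac_of (fun x y => y = r * x).
Definition ofrac_opp q : Q := ofrac_of (fun x y => q x (- y)).
Definition ofrac_add q q' : Q := ofrac_of (fun x s =>
  exists y y', [/\ q x y, q' x y' & s = y + y']).
Definition ofrac_mul q q' : Q := ofrac_of (fun x z => exists2 y, q' x y & q y z).
Definition ofrac_inv q : Q :=
  if q == ofrac_in 0 then q else ofrac_of (fun x y => q y x).

Lemma ofrac_inE r x : ofrac_in r x (r * x).
Proof.
apply: ofrac_ofP => // [|x1 y w ->|x1 y y' -> -> //]; last by rewrite mulrA.
by exists 1, r; rewrite oner_neq0 mulr1.
Qed.

Lemma ofrac_oppE q x y : q x y -> ofrac_opp q x (- y).
Proof.
move=> h; apply: ofrac_ofP; rewrite ?opprK //.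
- have [x0 [y0 [? ?]]] := ofrac_ex q; exists x0, (- y0); by rewrite opprK.
- by move=> x1 y1 w /(ofracM w); rewrite mulNr.
- by move=> x1 y1 y2 h1 /(ofrac_fun h1) /oppr_inj.
Qed.

Lemma ofrac_addE q q' x y y' : q x y -> q' x y' -> ofrac_add q q' x (y + y').
Proof.
move=> h h'; apply: ofrac_ofP; last by exists y, y'.
- have [x0 [y0 [y0' [? ? ?]]]] := ofrac_common q q'; exists x0, (y0 + y0').
  by split=> //; exists y0, y0'.
- move=> x1 s w [z [z' [hz hz' ->]]]; exists (z * w), (z' * w).
  by rewrite mulrDl; split=> //; apply: ofracM.
- move=> x1 s s' [z [z' [hz hz' ->]]] [t [t' [ht ht' ->]]].
  by rewrite (ofrac_fun hz ht) (ofrac_fun hz' ht').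
Qed.

Lemma ofrac_mulE q q' x y z : q' x y -> q y z -> ofrac_mul q q' x z.
Proof.
move=> h h'; apply: ofrac_ofP; last by exists y.
- have [x0 [y0 [x00 h0]]] := ofrac_ex q'; have [w [z0 [w0 h1]]] := ofrac_dom q y0.
  exists (x0 * w), z0; split; first exact: domR.
  by exists (y0 * w) => //; apply: ofracM.
- by move=> x1 z1 w [y1 h1 h2]; exists (y1 * w); apply: ofracM.
- move=> x1 z1 z2 [y1 h1 h2] [y2 h3 h4].
  by move: h4; rewrite -(ofrac_fun h1 h3); apply: ofrac_fun.
Qed.

Lemma ofrac_in0E x : ofrac_in 0 x 0.
Proof. by have := ofrac_inE 0 x; rewrite mul0r. Qed.

Lemma ofrac_in1E x : ofrac_in 1 x x.
Proof. by have := ofrac_inE 1 x; rewrite mul1r. Qed.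

Lemma ofrac_eq_in0 q x : x != 0 -> q x 0 -> q = ofrac_in 0.
Proof. by move=> x0 h; apply: (ofrac_eq x0 h); apply: ofrac_in0E. Qed.

Lemma ofrac_invE q x y : q != ofrac_in 0 -> q x y -> ofrac_inv q y x.
Proof.
move=> q0 h; rewrite /ofrac_inv (negPf q0); apply: ofrac_ofP => //.
- have [x0 [y0 [x00 h0]]] := ofrac_ex q; exists y0, x0; split=> //.
  by apply: contraNneq q0 => y00; apply/eqP/(ofrac_eq_in0 x00); rewrite -y00.
- by move=> x1 y1 w; apply: ofracM.
- move=> x1 y1 y2 h1 /(ofracB h1); rewrite subrr => h2; apply/subr0_eq/eqP.
  by apply: contraNT q0 => nz; apply/eqP/(ofrac_eq_in0 nz).
Qed.

Lemma ofrac_addA : associative ofrac_add.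
Proof.
move=> q1 q2 q3; have [x [y [z [x0 h12 h3]]]] := ofrac_common (ofrac_add q1 q2) q3.
have [w [y1 [w0 h1]]] := ofrac_dom q1 x.
have [v [y2 [v0 h2]]] := ofrac_dom q2 (x * w).
have nz : x * w * v != 0 by do !apply: domR.
move: h1 h3 => /(ofracM v) h1 /(ofracM w) /(ofracM v) h3.
apply: (ofrac_eq nz); first by do !apply: ofrac_addE; eassumption.
by rewrite addrA; do !apply: ofrac_addE; eassumption.
Qed.

Lemma ofrac_addC : commutative ofrac_add.
Proof.
move=> q q'; have [x [y [z [x0 h h']]]] := ofrac_common q q'.
by apply: (ofrac_eq x0 (ofrac_addE h h')); rewrite addrC; apply: ofrac_addE.
Qed.

Lemma ofrac_add0 : left_id (ofrac_in 0) ofrac_add.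
Proof.
move=> q; have [x [y [x0 h]]] := ofrac_ex q; apply: (ofrac_eq x0 _ h).
by rewrite -[y]add0r; apply: ofrac_addE => //; apply: ofrac_in0E.
Qed.

Lemma ofrac_addN : left_inverse (ofrac_in 0) ofrac_opp ofrac_add.
Proof.
move=> q; have [x [y [x0 h]]] := ofrac_ex q; apply: (ofrac_eq_in0 x0).
by rewrite -(addNr y); apply: ofrac_addE => //; apply: ofrac_oppE.
Qed.

HB.instance Definition _ :=
  GRing.isZmodule.Build Q ofrac_addA ofrac_addC ofrac_add0 ofrac_addN.

Lemma ofrac_mulA : associative ofrac_mul.
Proof.
move=> q1 q2 q3; have [x [y [x0 h3]]] := ofrac_ex q3.
have [w [z [w0 h2]]] := ofrac_dom q2 y; have [v [t [v0 h1]]] := ofrac_dom q1 z.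
have nz : x * w * v != 0 by do !apply: domR.
move: h3 h2 => /(ofracM w) /(ofracM v) h3 /(ofracM v) h2.
by apply: (ofrac_eq nz (y := t)); do !(apply: ofrac_mulE; try eassumption).
Qed.

Lemma ofrac_mul1 : left_id (ofrac_in 1) ofrac_mul.
Proof.
move=> q; have [x [y [x0 h]]] := ofrac_ex q; apply: (ofrac_eq x0 _ h).
by apply: (ofrac_mulE h); apply: ofrac_in1E.
Qed.

Lemma ofrac_mulr1 : right_id (ofrac_in 1) ofrac_mul.
Proof.
move=> q; have [x [y [x0 h]]] := ofrac_ex q; apply: (ofrac_eq x0 _ h).
by apply: ofrac_mulE h; apply: ofrac_in1E.
Qed.

Lemma ofrac_mulDl : left_distributive ofrac_mul +%R.
Proof.
move=> q1 q2 q; have [x [y [x0 h]]] := ofrac_ex q.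
have [w [y1 [w0 h1]]] := ofrac_dom q1 y.
have [v [y2 [v0 h2]]] := ofrac_dom q2 (y * w).
have nz : x * w * v != 0 by do !apply: domR.
move: h h1 => /(ofracM w) /(ofracM v) h /(ofracM v) h1.
apply: (ofrac_eq nz); first by apply: (ofrac_mulE h); apply: ofrac_addE; eassumption.
by apply: ofrac_addE; apply: ofrac_mulE; eassumption.
Qed.

Lemma ofrac_mulDr : right_distributive ofrac_mul +%R.
Proof.
move=> q q1 q2; have [x [y1 [y2 [x0 h1 h2]]]] := ofrac_common q1 q2.
have [w [z1 [w0 hz1]]] := ofrac_dom q y1.
have [v [z2 [v0 hz2]]] := ofrac_dom q (y2 * w).
have nz : x * w * v != 0 by do !apply: domR.
move: h1 h2 hz1 => /(ofracM w) /(ofracM v) h1 /(ofracM w) /(ofracM v) h2 /(ofracM v) hz1.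
apply: (ofrac_eq nz (y := z1 * v + z2)).
  apply: ofrac_mulE; first by apply: ofrac_addE; eassumption.
  have := ofracB hz1 (ofracB (ofrac00 q) hz2).
  by rewrite !sub0r !opprK.
by apply: ofrac_addE; apply: ofrac_mulE; eassumption.
Qed.

Lemma ofrac_in_inj : injective ofrac_in.
Proof.
move=> r s E; rewrite -[r]mulr1 -[s]mulr1.
by apply: (ofrac_fun (ofrac_inE r 1)); rewrite E; apply: ofrac_inE.
Qed.

Lemma ofrac_1neq0 : ofrac_in 1 != 0.
Proof. by apply/eqP => /ofrac_in_inj/eqP; rewrite oner_eq0. Qed.

HB.instance Definition _ := GRing.Zmodule_isNzRing.Build Q ofrac_mulA
  ofrac_mul1 ofrac_mulr1 ofrac_mulDl ofrac_mulDr ofrac_1neq0.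

Lemma ofrac_in_zmod : zmod_morphism ofrac_in.
Proof.
move=> r s; apply: (ofrac_eq (oner_neq0 R) (ofrac_inE (r - s) 1)).
rewrite mulrBl; apply: ofrac_addE; first exact: ofrac_inE.
by apply: ofrac_oppE; apply: ofrac_inE.
Qed.
HB.instance Definition _ := GRing.isZmodMorphism.Build R Q ofrac_in ofrac_in_zmod.

Lemma ofrac_inM r s : ofrac_in (r * s) = ofrac_in r * ofrac_in s.
Proof.
apply: (ofrac_eq (oner_neq0 R) (ofrac_inE (r * s) 1)).
by rewrite -mulrA; apply: ofrac_mulE; apply: ofrac_inE.
Qed.
HB.instance Definition _ :=
  GRing.isMonoidMorphism.Build R Q ofrac_in (erefl, ofrac_inM).

Definition ofrac_scale (a : k) (q : Q) : Q := ofrac_in a%:A * q.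
Lemma ofrac_scaleA a b q : ofrac_scale a (ofrac_scale b q) = ofrac_scale (a * b) q.
Proof. by rewrite /ofrac_scale mulrA -rmorphM /= -scalerAl mul1r scalerA. Qed.
Lemma ofrac_scale1 : left_id 1 ofrac_scale.
Proof. by move=> q; rewrite /ofrac_scale scale1r rmorph1 mul1r. Qed.
Lemma ofrac_scaleDr : right_distributive ofrac_scale +%R.
Proof. by move=> a p q; rewrite /ofrac_scale mulrDr. Qed.
Lemma ofrac_scaleDl q : {morph ofrac_scale^~ q : a b / a + b}.
Proof. by move=> a b; rewrite /ofrac_scale scalerDl raddfD mulrDl. Qed.
HB.instance Definition _ := GRing.Zmodule_isLmodule.Build k Q
  ofrac_scaleA ofrac_scale1 ofrac_scaleDr ofrac_scaleDl.
Lemma ofrac_scaleAl (a : k) (p q : Q) : a *: (p * q) = a *: p * q.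
Proof. exact: mulrA. Qed.
HB.instance Definition _ := GRing.Lmodule_isLalgebra.Build k Q ofrac_scaleAl.
Lemma ofrac_scaleAr (a : k) (p q : Q) : a *: (p * q) = p * (a *: q).
Proof.
have [x [y [x0 h]]] := ofrac_ex q.
have [w [z [w0 h']]] := ofrac_dom p y.
have nz : x * w != 0 by apply: domR.
have h2 := ofracM w h.
apply: (ofrac_eq nz (y := a%:A * z)).
  apply: (@ofrac_mulE (ofrac_in a%:A) (p * q) _ z); last exact: ofrac_inE.
  exact: ofrac_mulE h2 h'.
have -> : a%:A * z = z * a%:A by rewrite -scalerAl -scalerAr mulr1 mul1r.
apply: (@ofrac_mulE p (a *: q) _ (y * w * a%:A)); last exact: ofracM.
apply: (@ofrac_mulE (ofrac_in a%:A) q _ (y * w)) => //.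
have -> : y * w * a%:A = a%:A * (y * w) by rewrite -scalerAl -scalerAr mulr1 mul1r.
exact: ofrac_inE.
Qed.
HB.instance Definition _ := GRing.Lalgebra_isAlgebra.Build k Q ofrac_scaleAr.

Lemma ofrac_in_scalable : scalable ofrac_in.
Proof.
by move=> a r; rewrite -mulr_algl ofrac_inM.
Qed.
HB.instance Definition _ :=
  GRing.isScalable.Build k R Q *:%R ofrac_in ofrac_in_scalable.

Lemma ofrac_mulV q : q != 0 -> ofrac_inv q * q = 1.
Proof.
move=> q0; have [x [y [x0 h]]] := ofrac_ex q; apply: (ofrac_eq x0 (y := x)).
  exact: ofrac_mulE h (ofrac_invE q0 h).
by apply: ofrac_in1E.
Qed.

Lemma ofrac_divr q : q != 0 -> q * ofrac_inv q = 1.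
Proof.
move=> q0; have [x [y [x0 h]]] := ofrac_ex q.
have y0 : y != 0.
  by apply: contraNneq q0 => y0; apply/eqP/(ofrac_eq_in0 x0); rewrite -y0.
apply: (ofrac_eq y0 (y := y)); first exact: ofrac_mulE (ofrac_invE q0 h) h.
by apply: ofrac_in1E.
Qed.

Definition ofrac_unit : pred Q := fun q => q != 0.

Lemma ofrac_unitP (p q : Q) : q * p = 1 /\ p * q = 1 -> ofrac_unit p.
Proof.
move=> [E _]; apply/eqP => p0; move: E; rewrite p0 mulr0 => /esym/eqP.
by rewrite oner_eq0.
Qed.

Lemma ofrac_inv_out : {in [predC ofrac_unit], ofrac_inv =1 id}.
Proof. by move=> q; rewrite !inE negbK /ofrac_inv => ->. Qed.

HB.instance Definition _ := GRing.NzRing_hasMulInverse.Build Q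
  ofrac_mulV ofrac_divr ofrac_unitP ofrac_inv_out.

Lemma ofrac_unitE q : (q \is a GRing.unit) = (q != 0).
Proof. by []. Qed.

Lemma ofrac_in_eq0 r : (ofrac_in r == 0) = (r == 0).
Proof. exact: (raddf_eq0 _ ofrac_in_inj). Qed.

Lemma ofrac_right q : exists r s, s != 0 /\ q = ofrac_in r / ofrac_in s.
Proof.
have [x [y [x0 h]]] := ofrac_ex q; exists y, x; split=> //.
rewrite -[LHS]mulr1 -(@mulrV _ (ofrac_in x)) ?ofrac_unitE ?ofrac_in_eq0 //.
rewrite mulrA; congr (_ * _); apply: (ofrac_eq (oner_neq0 R) (y := y)).
  by apply: ofrac_mulE h; rewrite -{2}[x]mulr1; apply: ofrac_inE.
by rewrite -{2}[y]mulr1; apply: ofrac_inE.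
Qed.

(** A right fraction r s^-1 is also a left fraction, by a common left multiple
    of r and s. *)
Lemma ofrac_left q : exists r s, s != 0 /\ q = (ofrac_in s)^-1 * ofrac_in r.
Proof.
have [r [s [s0 ->]]] := ofrac_right q.
have [u [v [u0 E]]] : exists u v : R, u != 0 /\ u * r = v * s.
  by have [_ _ lore] := oreR; apply: lore.
exists v, u; split=> //.
have unit_in x : x != 0 -> ofrac_in x \is a GRing.unit.
  by rewrite ofrac_unitE ofrac_in_eq0.
apply: (mulrI (unit_in u u0)); rewrite [RHS]mulVKr ?unit_in // [LHS]mulrA.
by rewrite -rmorphM E rmorphM /= mulrK ?unit_in.
Qed.

End OreFractions.

(** * The field k(c) and its derivation *)

(** The quotient rule in a form that avoids the quotients: if x e = n, then
    x' = (n' - x e') / e.  These two identities are stated over an abstract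
    field because normalization is costly in a field of fractions. *)
Lemma quotient_rule_mul (F : fieldType) (x y n m e d e' d' : F) :
  e != 0 -> d != 0 ->
  (n * (y * d) + x * e * m - x * y * (e' * d + e * d')) / (e * d) =
  x * ((m - y * d') / d) + (n - x * e') / e * y.
Proof. by move=> e0 d0; field; rewrite e0 d0. Qed.

Lemma quotient_rule_add (F : fieldType) (x y n m e d e' d' : F) :
  e != 0 -> d != 0 ->
  (n * d + x * e * d' + (m * e + y * d * e')
    - (x + y) * (e' * d + e * d')) / (e * d) =
  (n - x * e') / e + (m - y * d') / d.
Proof. by move=> e0 d0; field; rewrite e0 d0. Qed.

(** A separate name, since the structure of k-algebra is added to it. *)
Definition ratfun (k : fieldType) : Type := {fraction {poly k}}.

Section RationalFunctions.
Variable k : fieldType.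
Local Notation K := (ratfun k).

HB.instance Definition _ := GRing.Field.copy K {fraction {poly k}}.

Definition tofun (h : {poly k}) : K := FracField.tofrac h.
HB.instance Definition _ := GRing.RMorphism.copy tofun (@FracField.tofrac {poly k}).

Lemma tofun_eq0 h : (tofun h == 0) = (h == 0).
Proof. exact: tofrac_eq0. Qed.

Definition numer (x : K) : {poly k} := \n_(repr (x : {fraction {poly k}})).
Definition denom (x : K) : {poly k} := \d_(repr (x : {fraction {poly k}})).

Lemma denom_neq0 x : denom x != 0.
Proof. exact: denom_ratioP. Qed.

Lemma numer_denom (x : K) : x * tofun (denom x) = tofun (numer x).
Proof.
rewrite /tofun /numer /denom; move: x; elim/quotW => y.
unlock FracField.tofrac; rewrite -[LHS]FracField.pi_mul; apply/eqmodP.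
rewrite /= FracField.equivfE /FracField.mulf.
rewrite !numden_Ratio ?mulr1 ?oner_eq0 //=.
all: by rewrite ?FracField.equivf_r ?denom_ratioP.
Qed.

Lemma ratfunE (x : K) : exists n e, e != 0 /\ x * tofun e = tofun n.
Proof. by exists (numer x), (denom x); rewrite denom_neq0 numer_denom. Qed.

Definition scale_ratfun (a : k) (x : K) : K := tofun a%:P * x.
Lemma scale_ratfunA a b x : scale_ratfun a (scale_ratfun b x) = scale_ratfun (a * b) x.
Proof. by rewrite /scale_ratfun mulrA -rmorphM /= -polyCM. Qed.
Lemma scale_ratfun1 : left_id 1 scale_ratfun.
Proof. by move=> x; rewrite /scale_ratfun rmorph1 mul1r. Qed.
Lemma scale_ratfunDr : right_distributive scale_ratfun +%R.
Proof. by move=> a x y; rewrite /scale_ratfun mulrDr. Qed.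
Lemma scale_ratfunDl x : {morph scale_ratfun^~ x : a b / a + b}.
Proof. by move=> a b; rewrite /scale_ratfun polyCD rmorphD mulrDl. Qed.
HB.instance Definition _ := GRing.Zmodule_isLmodule.Build k K
  scale_ratfunA scale_ratfun1 scale_ratfunDr scale_ratfunDl.
Lemma scale_ratfunAl (a : k) (x y : K) : a *: (x * y) = a *: x * y.
Proof. exact: mulrA. Qed.
HB.instance Definition _ := GRing.Lmodule_isLalgebra.Build k K scale_ratfunAl.
HB.instance Definition _ := GRing.Lalgebra_isComAlgebra.Build k K.

Lemma tofun_scalable : scalable tofun.
Proof. by move=> a h; rewrite -mul_polyC rmorphM. Qed.
HB.instance Definition _ :=
  GRing.isScalable.Build k {poly k} K *:%R tofun tofun_scalable.

Definition ratder (x : K) : K :=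
  (tofun (numer x)^`() - x * tofun (denom x)^`()) / tofun (denom x).

(** The derivative does not depend on the chosen fraction. *)
Lemma ratderE x n e : e != 0 -> x * tofun e = tofun n ->
  ratder x = (tofun n^`() - x * tofun e^`()) / tofun e.
Proof.
move=> e0 E; have E0 := numer_denom x; have d0 := denom_neq0 x.
apply/eqP; rewrite eqr_div ?tofun_eq0 //; apply/eqP.
have {}E' : numer x * e = n * denom x.
  apply/eqP; rewrite -tofrac_eq -!/(tofun _) !rmorphM /= -E -E0; apply/eqP; ring.
move/(congr1 (fun h : {poly k} => tofun h^`())): E'.
rewrite !derivM !rmorphD !rmorphM /= -E -E0 => E'.
apply/subr0_eq; move/eqP: E'; rewrite -subr_eq0 => /eqP <-; ring.
Qed.

Lemma ratderP x : exists n e, [/\ e != 0, x * tofun e = tofun n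
  & ratder x = (tofun n^`() - x * tofun e^`()) / tofun e].
Proof. by exists (numer x), (denom x); rewrite denom_neq0 numer_denom. Qed.

Lemma ratder_poly h : ratder (tofun h) = tofun h^`().
Proof.
rewrite (@ratderE _ h 1) ?oner_neq0 ?rmorph1 ?mulr1 //.
by rewrite derivC rmorph0 mulr0 subr0 divr1.
Qed.

Lemma ratderM x y : ratder (x * y) = x * ratder y + ratder x * y.
Proof.
have [n [e [e0 Ex ->]]] := ratderP x; have [m [d [d0 Ey ->]]] := ratderP y.
rewrite (@ratderE _ (n * m) (e * d)) ?mulf_neq0 //; last first.
  by rewrite !rmorphM /= -Ex -Ey; ring.
rewrite !derivM !rmorphD !rmorphM /= -Ex -Ey.
by rewrite -quotient_rule_mul ?tofun_eq0.
Qed.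

Lemma ratderD x y : ratder (x + y) = ratder x + ratder y.
Proof.
have [n [e [e0 Ex ->]]] := ratderP x; have [m [d [d0 Ey ->]]] := ratderP y.
rewrite (@ratderE _ (n * d + m * e) (e * d)) ?mulf_neq0 //; last first.
  by rewrite rmorphD !rmorphM /= -Ex -Ey; ring.
rewrite !derivD !derivM !rmorphD !rmorphM /= -Ex -Ey.
by rewrite -quotient_rule_add ?tofun_eq0.
Qed.

Lemma ratder_linear : linear ratder.
Proof.
move=> a x y; rewrite ratderD -[a *: x]/(tofun a%:P * x) ratderM ratder_poly.
by rewrite derivC rmorph0 mul0r addr0.
Qed.
HB.instance Definition _ := GRing.isLinear.Build k K K *:%R ratder ratder_linear.

Definition ratfun_derivation : derivation K := Derivation ratderM.

End RationalFunctions.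

Lemma field_ore (F : fieldType) : ore_domain F.
Proof.
split; first by move=> x y x0 y0; apply: mulf_neq0.
  by move=> x y x0; exists x, y; split=> //; apply: mulrC.
by move=> x y x0; exists x, y; split=> //; apply: mulrC.
Qed.

Lemma ratfun_ore (k : fieldType) : ore_domain (ratfun k).
Proof. exact: field_ore. Qed.

(** * Subalgebras and generation *)

Section Subalgebra.
Variables (k : fieldType) (A : algType k) (S : A -> Prop).

Record subalgebra : Prop := Subalgebra {
  subalg1 : S 1;
  subalgD : forall x y, S x -> S y -> S (x + y);
  subalgM : forall x y, S x -> S y -> S (x * y);
  subalgZ : forall (a : k) x, S x -> S (a *: x) }.

Hypothesis subS : subalgebra.

Definition subalg_pred : {pred A} := fun x => `[<S x>].
Record subalg_type := SubalgType { subalg_val : A; _ : subalg_val \in subalg_pred }.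
HB.instance Definition _ := [isSub for subalg_val].
HB.instance Definition _ := [Choice of subalg_type by <:].

Lemma subalg_closed : GRing.subsemialg_closed subalg_pred.
Proof.
have S0 : S 0 by rewrite -(scale0r 1); exact: (subalgZ subS 0 (subalg1 subS)).
split.
- exact/asboolP/(subalg1 subS).
- by split=> [|x y /asboolP Sx /asboolP Sy]; apply/asboolP => //; apply: (subalgD subS).
- by move=> a x /asboolP Sx; apply/asboolP; apply: (subalgZ subS).
- by move=> x y /asboolP Sx /asboolP Sy; apply/asboolP; apply: (subalgM subS).
Qed.

(** The hypothesis is recorded in the type so that the algebra structure can be
    inferred from it. *)
Definition subalg_of := let _ := subS in subalg_type.
HB.instance Definition _ := SubChoice.on subalg_of.
HB.instance Definition _ :=
  GRing.SubChoice_isSubAlgebra.Build k A subalg_pred subalg_of subalg_closed.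

Lemma subalg_witness x : S x -> exists y : subalg_of, \val y = x.
Proof.
by move=> /asboolP Sx; exists (SubalgType Sx).
Qed.
Lemma subalg_valP (y : subalg_of) : S (\val y).
Proof. by case: y => y /= /asboolP. Qed.
Definition subalg_incl (x : subalg_of) : A := \val x.
HB.instance Definition _ :=
  GRing.RMorphism.copy subalg_incl (\val : subalg_of -> A).
HB.instance Definition _ :=
  GRing.Linear.copy subalg_incl (\val : subalg_of -> A).
End Subalgebra.

Lemma subalgebra_incl (k : fieldType) (A : algType k) (S : A -> Prop) :
  subalgebra S -> exists (B : algType k) (i : {lrmorphism B -> A}),
    [/\ injective i, forall x, S x -> exists y, i y = x & forall y, S (i y)].
Proof.
move=> subS; exists (subalg_of subS), (@subalg_incl _ _ _ subS).
split; [exact: val_inj | exact: subalg_witness | exact: subalg_valP].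
Qed.

Lemma horner_alg_unique (k : fieldType) (A : algType k)
    (F : {rmorphism {poly k} -> A}) :
  (forall a, F a%:P = a%:A) -> F =1 horner_alg (F 'X).
Proof.
move=> FC; elim/poly_ind => [|p a IHp]; first by rewrite !rmorph0.
by rewrite !rmorphD !rmorphM /= -IHp horner_algC horner_algX FC.
Qed.

Lemma horner_alg_map (k : fieldType) (A B : algType k)
    (phi : {lrmorphism A -> B}) (x : A) h :
  phi (horner_alg x h) = horner_alg (phi x) h.
Proof.
have E := @horner_alg_unique k B (phi \o horner_alg x).
rewrite -[LHS]/((phi \o horner_alg x) h) E /= ?horner_algX // => a.
by rewrite horner_algC linearZ rmorph1.
Qed.

(** The generators generate: the universal property gives a morphism into the
    subalgebra S whose composite with the inclusion fixes the generators, so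
    it is the identity by uniqueness. *)
Lemma P_gen (k : fieldType) (f g : {poly k}) (P : algType k) (a c d : P)
    (S : P -> Prop) : is_P f g a c d ->
  subalgebra S -> S a -> S c -> S d -> forall x, S x.
Proof.
case=> rels univ uniq subS Sa Sc Sd x.
have [B [i [inj liftS iS]]] := subalgebra_incl subS.
have [[a' Ea] [c' Ec] [d' Ed]] := And3 (liftS _ Sa) (liftS _ Sc) (liftS _ Sd).
have relB : P_relations f g a' c' d'.
  case: rels => r1 r2 r3; split; apply: inj;
    by rewrite !(rmorphD, rmorphN, rmorphM) /= ?horner_alg_map ?Ea ?Ec ?Ed.
have [phi [Pa Pc Pd]] := univ B a' c' d' relB.
pose e : {lrmorphism P -> P} := i \o phi.
pose e1 : {lrmorphism P -> P} := idfun.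
have -> : x = e x.
  by apply: (uniq _ e1 e); rewrite /e /e1 /= ?Pa ?Pc ?Pd.
exact: iS.
Qed.

Lemma MJ2_gen (k : fieldType) (M : algType k) (a b c d : M) (S : M -> Prop) :
  is_MJ2 a b c d ->
  subalgebra S -> S a -> S b -> S c -> S d -> forall x, S x.
Proof.
case=> rels univ uniq subS Sa Sb Sc Sd x.
have [B [i [inj liftS iS]]] := subalgebra_incl subS.
have [[a' Ea] [b' Eb]] := conj (liftS _ Sa) (liftS _ Sb).
have [[c' Ec] [d' Ed]] := conj (liftS _ Sc) (liftS _ Sd).
have relB : MJ2_relations a' b' c' d'.
  case: rels => r1 r2 [r3 r4 r5 r6]; split; [| | split]; apply: inj;
    rewrite ?expr2 in r1 r2 r3 r4 r5 r6 *;
    by rewrite !(rmorphD, rmorphN, rmorphM) /= ?Ea ?Eb ?Ec ?Ed.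
have [phi [Pa Pb Pc Pd]] := univ B a' b' c' d' relB.
pose e : {lrmorphism M -> M} := i \o phi.
pose e1 : {lrmorphism M -> M} := idfun.
have -> : x = e x.
  by apply: (uniq _ e1 e); rewrite /e /e1 /= ?Pa ?Pb ?Pc ?Pd.
exact: iS.
Qed.

(** * Normal forms in an algebra with the relations of P(f,g) *)

(** The sums of t_i z^i with the t_i in T, in Horner form, so that induction on
    the number of terms is the induction principle of the type. *)
Inductive horner_span (A : nzRingType) (T : A -> Prop) (z : A) : A -> Prop :=
| HornerSpan0 : horner_span T z 0
| HornerSpanS x t : horner_span T z x -> T t -> horner_span T z (x * z + t).

Section Span.
Variables (k : fieldType) (A : algType k) (T : A -> Prop) (z : A).
Hypothesis subT : subalgebra T.
Local Notation span := (horner_span T z).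

Lemma subalg0 : T 0.
Proof. by rewrite -(scale0r 1); apply: (subalgZ subT); apply: (subalg1 subT). Qed.

Lemma span_base t : T t -> span t.
Proof. by move=> Tt; rewrite -[t]add0r -(mul0r z); do !constructor. Qed.

Lemma spanD x y : span x -> span y -> span (x + y).
Proof.
move=> sx; elim: sx y => [|x' t sx IH Tt] y; first by rewrite add0r.
case=> [|y' s sy Ts]; first by rewrite addr0; constructor.
by rewrite addrACA -mulrDl; constructor; [apply: IH | apply: (subalgD subT)].
Qed.

Lemma spanMr x : span x -> span (x * z).
Proof.
by move=> sx; rewrite -[_ * z]addr0; constructor=> //; apply: subalg0.
Qed.

Lemma span_var : span z.
Proof. by have := spanMr (span_base (subalg1 subT)); rewrite mul1r. Qed.

Lemma span_mull w x :
  (forall t, T t -> exists t1 t2, [/\ T t1, T t2 & w * t = t1 * z + t2]) ->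
  span x -> span (w * x).
Proof.
move=> wT; elim=> [|{}x t sx IH Tt]; first by rewrite mulr0; constructor.
have [t1 [t2 [T1 T2 E]]] := wT t Tt.
rewrite mulrDr mulrA E addrA -mulrDl; constructor=> //.
by apply: spanD => //; apply: span_base.
Qed.

(** The commutation rule moves z to the right of T, so a product of two sums
    can be put back in the form of a sum. *)
Lemma span_subalgebra :
  (forall t, T t -> exists t1 t2, [/\ T t1, T t2 & z * t = t1 * z + t2]) ->
  subalgebra span.
Proof.
move=> zT.
have TT s x : T s -> span x -> span (s * x).
  move=> Ts; apply: span_mull => t Tt; exists 0, (s * t).
  by rewrite mul0r add0r; split=> //; [apply: subalg0 | apply: (subalgM subT)].
split; first by apply: span_base; apply: (subalg1 subT).
- exact: spanD.
- move=> x y sx; elim: sx y => [|{}x t sx IH Tt] y sy; first by rewrite mul0r; constructor.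
  rewrite mulrDl -mulrA; apply: spanD; last exact: TT.
  by apply: IH; apply: span_mull.
- move=> a x sx; rewrite -mulr_algl; apply: TT => //.
  by apply: (subalgZ subT); apply: (subalg1 subT).
Qed.

Lemma span_min (S : A -> Prop) : subalgebra S -> (forall t, T t -> S t) ->
  S z -> forall x, span x -> S x.
Proof.
move=> subS TS Sz x; elim=> [|{}x t sx IH Tt].
  by rewrite -(scale0r 1); apply: (subalgZ subS); apply: (subalg1 subS).
by apply: (subalgD subS); [apply: (subalgM subS) | apply: TS].
Qed.

End Span.

(** Injectivity passes from T to the sums of t_i z^i when the image of z is
    transcendental over E1, which contains the image of T.  E2 stands for the
    subring in which the image of the span lives. *)
Lemma faithful_span (A E : nzRingType) (phi : {rmorphism A -> E})
    (T : A -> Prop) (z : A) (E1 E2 : E -> Prop) :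
  E2 0 ->
  (forall p r, E2 p -> E1 r -> E2 (p * phi z + r)) ->
  (forall p r, E2 p -> E1 r -> p * phi z + r = 0 -> p = 0 /\ r = 0) ->
  (forall x, T x -> E1 (phi x) /\ (phi x = 0 -> x = 0)) ->
  forall x, horner_span T z x -> E2 (phi x) /\ (phi x = 0 -> x = 0).
Proof.
move=> E20 E2S free faithT x; elim=> [|{}x t _ [Ex x0] Tt].
  by rewrite rmorph0; split.
have [Et t0] := faithT t Tt; rewrite rmorphD rmorphM /=; split; first exact: E2S.
by case/(free _ _ Ex Et) => /x0 -> /t0 ->; rewrite mul0r addr0.
Qed.

Section PAlgebra.
Variables (k : fieldType) (f g : {poly k}) (A : algType k) (a c d : A).
Hypothesis rels : P_relations f g a c d.
Local Notation u := (d - a).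
Local Notation hc := (horner_alg c).

Lemma P_ac : a * c = c * a + hc f. Proof. by case: rels. Qed.
Lemma P_uc : u * c = c * u.
Proof. by case: rels => r1 r2 _; rewrite mulrBl mulrBr r1 r2 opprD addrACA subrr addr0. Qed.
Lemma P_ua : u * a = (a - hc g) * u.
Proof.
case: rels => _ _ r3; rewrite mulrBl r3 mulrBr [(a - _) * a]mulrBl.
by rewrite opprB addrA.
Qed.

Lemma horner_alg_comm (x : A) h : x * c = c * x -> x * hc h = hc h * x.
Proof.
move=> xc; elim/poly_ind: h => [|h r IH]; first by rewrite rmorph0 mulr0 mul0r.
rewrite rmorphD rmorphM /= horner_algX horner_algC mulrDr mulrDl.
by rewrite mulrA IH -!mulrA xc mulr_algr mulr_algl.
Qed.

(** On k[c] the commutator with a is the derivation f d/dc. *)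
Lemma P_apoly h : a * hc h = hc h * a + hc (f * h^`()).
Proof.
elim/poly_ind: h => [|h r IH].
  by rewrite deriv0 mulr0 !rmorph0 mulr0 mul0r addr0.
have -> : f * (h * 'X + r%:P)^`() = f * h^`() * 'X + f * h.
  by rewrite derivD derivC addr0 derivM derivX mulr1 mulrDr mulrA.
have hcM x y : hc (x * y) = hc x * hc y by exact: rmorphM.
have hcD x y : hc (x + y) = hc x + hc y by exact: rmorphD.
rewrite !hcD !hcM horner_algX horner_algC !mulrDr !mulrDl mulrA IH mulrDl.
rewrite -[_ * a * c]mulrA P_ac mulrDr mulr_algr mulr_algl !mulrA.
by rewrite -!hcM [h * f]mulrC -!addrA; congr (_ + _); rewrite addrA addrC addrA
  [X in _ = _ + X]addrC addrA.
Qed.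

(** With the variables in the order c, a, u, each can be moved to the right of
    the span of the earlier ones. *)
Definition c_span (x : A) : Prop := exists h, x = hc h.
Definition ca_span := horner_span c_span a.
Definition cau_span := horner_span ca_span u.

Lemma c_span_subalgebra : subalgebra c_span.
Proof.
split; first by exists 1; rewrite rmorph1.
- by move=> x y [h ->] [h' ->]; exists (h + h'); rewrite rmorphD.
- by move=> x y [h ->] [h' ->]; exists (h * h'); rewrite rmorphM.
- move=> r x [h ->]; exists (r%:P * h).
  by rewrite rmorphM /= horner_algC mulr_algl.
Qed.

Lemma ca_span_subalgebra : subalgebra ca_span.
Proof.
apply: (span_subalgebra c_span_subalgebra) => _ [h ->].
exists (hc h), (hc (f * h^`())); split; [by exists h | by eexists | exact: P_apoly].
Qed.

Lemma cau_span_subalgebra : subalgebra cau_span.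
Proof.
apply: (span_subalgebra ca_span_subalgebra) => x sx.
suff [y sy E] : exists2 y, ca_span y & u * x = y * u.
  by exists y, 0; rewrite addr0; split=> //; apply: subalg0 ca_span_subalgebra.
elim: sx => [|y _ _ [y' sy E] [h ->]].
  by exists 0; rewrite ?mulr0 ?mul0r //; apply: subalg0 ca_span_subalgebra.
have base h' : ca_span (hc h') by apply: span_base; exists h'.
exists (y' * (a - hc g) + hc h).
  apply: (subalgD ca_span_subalgebra) => //; apply: (subalgM ca_span_subalgebra) => //.
  apply: (subalgD ca_span_subalgebra); first exact: (span_var a c_span_subalgebra).
  by rewrite -rmorphN; apply: base.
rewrite mulrDr mulrA E -[y' * u * a]mulrA P_ua mulrA [RHS]mulrDl.
by rewrite horner_alg_comm // P_uc.
Qed.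

Lemma cau_span_c : cau_span c.
Proof.
do 2!apply: span_base.
by exists 'X; rewrite horner_algX.
Qed.

Lemma cau_span_a : cau_span a.
Proof. by apply: span_base; apply: (span_var a c_span_subalgebra). Qed.

Lemma cau_span_u : cau_span u.
Proof. exact: (span_var _ ca_span_subalgebra). Qed.

Lemma cau_span_d : cau_span d.
Proof.
by rewrite -(subrK a d); apply: (subalgD cau_span_subalgebra);
  [exact: cau_span_u | exact: cau_span_a].
Qed.

(** As d = a + u, this span is the subalgebra generated by a, c and d. *)
Lemma cau_span_min (S : A -> Prop) : subalgebra S -> S a -> S c -> S d ->
  forall x, cau_span x -> S x.
Proof.
move=> subS Sa Sc Sd; apply: (span_min subS); last first.
  apply: (subalgD subS) => //; rewrite -scaleN1r; exact: (subalgZ subS).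
apply: (span_min subS) => // _ [h ->].
elim/poly_ind: h => [|h r IH]; first by rewrite rmorph0; apply: (subalg0 subS).
rewrite rmorphD rmorphM /= horner_algX horner_algC.
apply: (subalgD subS); first exact: (subalgM subS).
by apply: (subalgZ subS); apply: (subalg1 subS).
Qed.
End PAlgebra.

Lemma is_P_span (k : fieldType) (f g : {poly k}) (P : algType k) (a c d : P) :
  is_P f g a c d -> forall x, cau_span a c d x.
Proof.
move=> isP; have [rels _ _] := isP; apply: (P_gen isP (cau_span_subalgebra rels)).
- exact: cau_span_a.
- exact: cau_span_c.
- exact: (cau_span_d rels).
Qed.

(** * The algebra k(c)[y; d/dc][s,t] and its fractions *)

(** W = k(c)[y; d/dc][s][t] with exactly the properties that are used: the
    commutation rules, generation and, for nonzero x in k(c), transcendence of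
    x y over k(c), of x s over weyl1 = k(c)[y; d/dc], and of x t + e over
    weyl2 = k(c)[y; d/dc][s] for e in weyl2. *)
Record weyl_structure (k : fieldType) := WeylStructure {
  weyl :> algType k;
  wcoef : {lrmorphism ratfun k -> weyl};
  wy : weyl;
  ws : weyl;
  wt : weyl;
  weyl1 : weyl -> Prop;
  weyl2 : weyl -> Prop;
  weyl_ore : ore_domain weyl;
  wy_coef : forall x, wy * wcoef x = wcoef x * wy + wcoef (ratder x);
  ws_central : forall w, ws * w = w * ws;
  wt_central : forall w, wt * w = w * wt;
  weyl_gen : forall G : weyl -> Prop,
    (forall p q, G p -> G q -> G (p + q)) ->
    (forall p q, G p -> G q -> G (p * q)) ->
    (forall x, G (wcoef x)) -> G wy -> G ws -> G wt -> forall w, G w;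
  weyl1_sub : subalgebra weyl1;
  weyl1_coef : forall x, weyl1 (wcoef x);
  weyl1_y : weyl1 wy;
  weyl2_sub : subalgebra weyl2;
  weyl2_1 : forall w, weyl1 w -> weyl2 w;
  weyl2_s : weyl2 ws;
  wy_free : forall p x r, weyl1 p -> x != 0 ->
    p * (wcoef x * wy) + wcoef r = 0 -> p = 0 /\ wcoef r = 0;
  ws_free : forall p x r, weyl2 p -> weyl1 r -> x != 0 ->
    p * (wcoef x * ws) + r = 0 -> p = 0 /\ r = 0;
  wt_free : forall p x e r, weyl2 e -> weyl2 r -> x != 0 ->
    p * (wcoef x * wt + e) + r = 0 -> p = 0 /\ r = 0 }.

Lemma image_subalgebra (k : fieldType) (A B : algType k)
    (phi : {lrmorphism A -> B}) : subalgebra (fun y => exists x, y = phi x).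
Proof.
split; first by exists 1; rewrite rmorph1.
- by move=> _ _ [x ->] [y ->]; exists (x + y); rewrite rmorphD.
- by move=> _ _ [x ->] [y ->]; exists (x * y); rewrite rmorphM.
- by move=> a _ [x ->]; exists (a *: x); rewrite linearZ.
Qed.

Lemma weyl_exists (k : fieldType) : inhabited (weyl_structure k).
Proof.
have [W0 [V0 [y [ore0 comm0 gen0 free0]]]] :=
  skew_extension_exists (ratfun_derivation k) (ratfun_ore k).
have [W1 [V1 [s [ore1 comm1 gen1 free1]]]] :=
  skew_extension_exists (zero_derivation W0) ore0.
have [W2 [V2 [t [ore2 comm2 gen2 free2]]]] :=
  skew_extension_exists (zero_derivation W1) ore1.
have sC w : s * w = w * s.
  move: w; apply: gen1 => [p q Ep Eq|p q Ep Eq|r|] //.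
  - by rewrite mulrDr mulrDl Ep Eq.
  - by rewrite mulrA Ep -!mulrA Eq.
  - by rewrite comm1 raddf0 addr0.
have tC w : t * w = w * t.
  move: w; apply: gen2 => [p q Ep Eq|p q Ep Eq|r|] //.
  - by rewrite mulrDr mulrDl Ep Eq.
  - by rewrite mulrA Ep -!mulrA Eq.
  - by rewrite comm2 raddf0 addr0.
have V0_eq0 r : (V0 r == 0) = (r == 0) by exact: (fmorph_eq0 V0 r).
have V1_inj r : V1 r = 0 -> r = 0.
  move=> E; have [] // := free1 0 1 0 r (oner_neq0 W0).
  by rewrite mul0r add0r.
have V2_inj r : V2 r = 0 -> r = 0.
  move=> E; have [] // := free2 0 1 0 r (oner_neq0 W1).
  by rewrite mul0r add0r.
pose V21 : {lrmorphism W0 -> W2} := V2 \o V1.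
pose V210 : {lrmorphism ratfun k -> W2} := V21 \o V0.
split; refine (@WeylStructure k W2 V210 (V21 y) (V2 s) t
  (fun w => exists r, w = V21 r) (fun w => exists r, w = V2 r)
  ore2 _ _ tC _ _ _ _ _ _ _ _ _ _).
- by move=> x; rewrite /V210 /= -!rmorphM comm0 !rmorphD.
- move=> w; move: w; apply: gen2 => [p q Ep Eq|p q Ep Eq|r|] //.
  + by rewrite mulrDr mulrDl Ep Eq.
  + by rewrite mulrA Ep -!mulrA Eq.
  + by rewrite -!rmorphM sC.
- move=> G GD GM Gk Gy Gs Gt; apply: gen2 => //.
  apply: (gen1 (fun r => G (V2 r))) => // [p q|p q|].
  + by rewrite rmorphD; apply: GD.
  + by rewrite rmorphM; apply: GM.
  apply: (gen0 (fun r => G (V2 (V1 r)))) => // [p q|p q].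
  + by rewrite !rmorphD; apply: GD.
  + by rewrite !rmorphM; apply: GM.
- exact: image_subalgebra.
- by move=> x; exists (V0 x).
- by exists y.
- exact: image_subalgebra.
- by move=> _ [r ->]; exists (V1 r).
- by exists s.
- move=> _ x r [p ->] x0 E.
  have [|-> ->] := free0 p x 0 r x0; last by rewrite !rmorph0.
  apply: V1_inj; apply: V2_inj; move: E.
  by rewrite /V210 /V21 /= !(raddf0, addr0) !(rmorphD, rmorphM).
- move=> _ x _ [p ->] [r ->] x0 E.
  have [||-> ->] := free1 p (V0 x) 0 r; rewrite ?V0_eq0 //; last by rewrite !rmorph0.
  apply: V2_inj; move: E.
  by rewrite /V210 /V21 /= !(raddf0, addr0) !(rmorphD, rmorphM).
- move=> p x _ _ [e ->] [r ->] x0 E.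
  have [||-> ->] := free2 p (V1 (V0 x)) e r; rewrite ?rmorph0 //.
  by apply/eqP => /V1_inj/eqP; rewrite V0_eq0 (negPf x0).
Qed.

Section WeylAlgebra.
Variables (k : fieldType) (W : weyl_structure k).
Local Notation K := (ratfun k).
Local Notation wcoef := (wcoef W).
Local Notation wy := (wy W).
Local Notation ws := (ws W).
Local Notation wt := (wt W).

Definition wpoly : {lrmorphism {poly k} -> W} := wcoef \o @tofun k.

Lemma wpoly_eq0 h : (wpoly h == 0) = (h == 0).
Proof. by rewrite -tofun_eq0 -[RHS](fmorph_eq0 wcoef). Qed.

Lemma wpoly_horner h : horner_alg (wcoef (tofun 'X)) h = wpoly h.
Proof.
have wC a : wpoly a%:P = a%:A by rewrite -alg_polyC linearZ /= !rmorph1.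
exact: esym (@horner_alg_unique _ _ wpoly wC h).
Qed.

Lemma wy_poly h : wy * wpoly h = wpoly h * wy + wpoly h^`().
Proof. by rewrite wy_coef ratder_poly. Qed.

(** The images of a, c and u = d - a. *)
Definition wa f : W := wpoly f * wy.
Definition wc : W := wpoly 'X.
Definition wu : W := wpoly 'X * ws.

Lemma weyl_P_relations f g : f = 'X * g ->
  P_relations f g (wa f) wc (wa f + wu).
Proof.
move=> Ef.
have Eac : wa f * wc = wc * wa f + wpoly f.
  rewrite /wa /wc -mulrA wy_poly derivX rmorph1 mulrDr mulr1 !mulrA.
  by rewrite -!rmorphM mulrC.
have Euc : wu * wc = wc * wu by rewrite /wu /wc -mulrA ws_central mulrA.
have Eua : wu * wa f = wa f * wu - wpoly g * wu.
  rewrite /wu /wa -!mulrA ws_central [wy * _]mulrA wy_poly derivX rmorph1.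
  rewrite mulrDl mul1r mulrDr !mulrA -!rmorphM mulrC [g * _]mulrC -Ef -!mulrA.
  by rewrite addrK.
split; rewrite !wpoly_horner //; first by rewrite mulrDl mulrDr Eac Euc addrAC.
by rewrite mulrDl Eua mulrBl !mulrDr opprD [- _ - _]addrC !addrA subrK.
Qed.

Section Faithful.
Variables (f : {poly k}) (A : algType k) (a c d : A).
Variable phi : {lrmorphism A -> W}.
Hypothesis f0 : f != 0.
Hypotheses (phia : phi a = wa f) (phic : phi c = wc) (phiu : phi (d - a) = wu).

Lemma cau_span_faithful x : cau_span a c d x ->
  @weyl2 k W (phi x) /\ (phi x = 0 -> x = 0).
Proof.
move: x; apply: (@faithful_span _ _ phi _ _ (@weyl1 k W)).
- exact: subalg0 (weyl2_sub W).
- move=> p r Ep Er; rewrite [X in _ * X]phiu; apply: (subalgD (weyl2_sub W));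
    last exact: weyl2_1.
  apply: (subalgM (weyl2_sub W)) => //; apply: (subalgM (weyl2_sub W)).
    by apply/weyl2_1/weyl1_coef.
  exact: weyl2_s.
- move=> p r Ep Er; rewrite [X in _ * X]phiu; apply: ws_free => //.
  by rewrite tofun_eq0 polyX_eq0.
apply: (@faithful_span _ _ phi _ _ (fun w => exists x, w = wcoef x)).
- exact: subalg0 (weyl1_sub W).
- move=> p _ Ep [r ->]; rewrite [X in _ * X]phia; apply: (subalgD (weyl1_sub W));
    last exact: weyl1_coef.
  apply: (subalgM (weyl1_sub W)) => //; apply: (subalgM (weyl1_sub W)).
    exact: weyl1_coef.
  exact: weyl1_y.
- by move=> p _ Ep [r ->]; rewrite [X in _ * X]phia; apply: wy_free; rewrite ?tofun_eq0.
move=> _ [h ->]; rewrite -[GRing.RMorphism.sort _ _]/(phi _) horner_alg_map phic wpoly_horner.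
split=> [|/eqP]; first by exists (tofun h).
by rewrite wpoly_eq0 => /eqP ->; rewrite rmorph0.
Qed.

Lemma horner_span_faithful (b : A) (x : K) (e : W) (T : A -> Prop) :
  x != 0 -> @weyl2 k W e -> phi b = wcoef x * wt + e ->
  (forall y, T y -> @weyl2 k W (phi y) /\ (phi y = 0 -> y = 0)) ->
  forall y, horner_span T b y -> phi y = 0 -> y = 0.
Proof.
move=> x0 We Eb faithT y sy.
have [] // := @faithful_span _ _ phi T b (@weyl2 k W) (fun _ => True) _ _ _ faithT y sy.
by move=> p r _ Wr; rewrite [X in _ * X]Eb; apply: wt_free.
Qed.
End Faithful.

(** Elements of W as fractions with respect to a subalgebra that contains
    k[c], f y, c s and t.  Denominators in k[c] suffice. *)
Section Fractions.
Variables (f : {poly k}) (B : algType k) (a c u t : B).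
Variable phi : {lrmorphism B -> W}.
Hypothesis f0 : f != 0.
Hypotheses (phia : phi a = wa f) (phic : phi c = wc) (phiu : phi u = wu).
Hypothesis phit : phi t = wt.

Let im w := exists r, w = phi r.
Let imD w w' : im w -> im w' -> im (w + w').
Proof. by move=> [r ->] [s ->]; exists (r + s); rewrite rmorphD. Qed.
Let imM w w' : im w -> im w' -> im (w * w').
Proof. by move=> [r ->] [s ->]; exists (r * s); rewrite rmorphM. Qed.
Let imp h : im (wpoly h).
Proof. by exists (horner_alg c h); rewrite horner_alg_map phic wpoly_horner. Qed.

#[local] Hint Resolve imp : core.

Let wpolyC h h' : wpoly h * wpoly h' = wpoly h' * wpoly h.
Proof. by rewrite -!rmorphM mulrC. Qed.

(** The set of w with a right denominator is stable under right multiplication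
    by each generator of W.  For y the denominator h becomes h^2 f, as
    y h^2 f = h (h a + 2 h' f + h f'). *)
Lemma weyl_right_denominator w : exists h, h != 0 /\ im (w * wpoly h).
Proof.
pose D w := exists h, h != 0 /\ im (w * wpoly h).
suff DM : forall v w, D w -> D (w * v).
  rewrite -[w]mul1r; apply: DM; exists 1.
  by rewrite oner_neq0 mul1r; split=> //; apply: imp.
apply: weyl_gen => [p q Gp Gq v Dv|p q Gp Gq v Dv|x v [h [h0 imh]]|v [h [h0 imh]]
  |v [h [h0 imh]]|v [h [h0 imh]]].
- have [h [h0 imh]] := Gp v Dv; have [h' [h'0 imh']] := Gq v Dv.
  exists (h * h'); rewrite mulf_neq0 //; split=> //.
  rewrite mulrDr mulrDl rmorphM {2}wpolyC !mulrA.
  by apply: imD; apply: imM => //; apply: imp.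
- by rewrite mulrA; apply: Gq; apply: Gp.
- have [n [e [e0 E]]] := ratfunE x; exists (e * h); rewrite mulf_neq0 //; split=> //.
  have -> : v * wcoef x * wpoly (e * h) = v * wpoly h * wpoly n.
    rewrite -!mulrA -[wpoly n]/(wcoef (tofun n)) -[wpoly h]/(wcoef (tofun h)).
    rewrite -[wpoly _]/(wcoef (tofun (e * h))) -E -!rmorphM; congr (_ * wcoef _).
    by rewrite rmorphM mulrA mulrC.
  by apply: imM => //; apply: imp.
- exists (h ^+ 2 * f); rewrite mulf_neq0 ?expf_neq0 //; split=> //.
  rewrite -mulrA wy_poly expr2 !derivM.
  have -> : wpoly (h * h * f) * wy + wpoly ((h^`() * h + h * h^`()) * f + h * h * f^`())
     = wpoly h * (wpoly h * wa f + wpoly (h^`() * f *+ 2 + h * f^`())).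
    rewrite mulrDr mulrA /wa mulrA -!rmorphM; congr (_ + wpoly _); ring.
  rewrite mulrA; apply: imM => //; apply: imD => //; apply: imM => //.
  by exists a.
- exists ('X * h); rewrite mulf_neq0 ?polyX_eq0 //; split=> //.
  have -> : v * ws * wpoly ('X * h) = v * wpoly h * wu.
    by rewrite /wu -!mulrA ws_central [wpoly h * _]mulrA -rmorphM [h * _]mulrC.
  by apply: imM => //; exists u.
- exists h; split=> //; rewrite -mulrA wt_central mulrA; apply: imM => //.
  by exists t.
Qed.

Lemma weyl_left_denominator w : exists h, h != 0 /\ im (wpoly h * w).
Proof.
pose D w := exists h, h != 0 /\ im (wpoly h * w).
suff DM : forall v w, D w -> D (v * w).
  rewrite -[w]mulr1; apply: DM; exists 1.
  by rewrite oner_neq0 mulr1; split=> //; apply: imp.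
apply: weyl_gen => [p q Gp Gq v Dv|p q Gp Gq v Dv|x v [h [h0 imh]]|v [h [h0 imh]]
  |v [h [h0 imh]]|v [h [h0 imh]]].
- have [h [h0 imh]] := Gp v Dv; have [h' [h'0 imh']] := Gq v Dv.
  exists (h * h'); rewrite mulf_neq0 //; split=> //.
  rewrite mulrDl mulrDr rmorphM {1}wpolyC -!mulrA.
  by apply: imD; apply: imM => //; apply: imp.
- by rewrite -mulrA; apply: Gp; apply: Gq.
- have [n [e [e0 E]]] := ratfunE x; exists (h * e); rewrite mulf_neq0 //; split=> //.
  have -> : wpoly (h * e) * (wcoef x * v) = wpoly n * (wpoly h * v).
    rewrite !mulrA -[wpoly n]/(wcoef (tofun n)) -[wpoly h]/(wcoef (tofun h)).
    rewrite -[wpoly _]/(wcoef (tofun (h * e))) -E -!rmorphM; congr (wcoef _ * _).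
    by rewrite [h * e]mulrC rmorphM mulrC mulrA.
  by apply: imM => //; apply: imp.
- exists (h ^+ 2 * f); rewrite mulf_neq0 ?expf_neq0 //; split=> //.
  have -> : wpoly (h ^+ 2 * f) * (wy * v)
     = (wa f * wpoly h - wpoly (h^`() * f *+ 2)) * (wpoly h * v).
    rewrite !mulrA; congr (_ * v).
    rewrite mulrBl /wa -!mulrA -rmorphM wy_poly mulrDr mulrA -!rmorphM.
    rewrite derivM.
    have -> : f * (h^`() * h + h * h^`()) = h^`() * f *+ 2 * h by ring.
    by rewrite addrK [RHS]mulrA -rmorphM [f * _]mulrC.
  apply: imM => //; apply: imD; last by rewrite -rmorphN; apply: imp.
  by apply: imM => //; exists a.
- exists ('X * h); rewrite mulf_neq0 ?polyX_eq0 //; split=> //.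
  have -> : wpoly ('X * h) * (ws * v) = wu * (wpoly h * v).
    by rewrite /wu -!mulrA [ws * (_ * _)]mulrA [ws * wpoly h]ws_central !mulrA -rmorphM.
  by apply: imM => //; exists u.
- exists h; split=> //; rewrite mulrA -wt_central -mulrA; apply: imM => //.
  by exists t.
Qed.

Hypothesis phi_inj : forall x, phi x = 0 -> x = 0.

Lemma weyl_quotient_ring (l := ofrac_in (weyl_ore W) \o phi) :
  classical_quotient_ring (l : {lrmorphism B -> ofrac (weyl_ore W)}).
Proof.
have domW : domain W by have [] := weyl_ore W.
have phi_eq0 x : (phi x == 0) = (x == 0).
  by apply/eqP/eqP => [/phi_inj // | ->]; rewrite rmorph0.
have domB (x y : B) : x != 0 -> y != 0 -> x * y != 0.
  by rewrite -!phi_eq0 rmorphM; apply: domW.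
have reg0 (s : B) : regular s -> s != 0.
  move=> [regs _]; apply/eqP => s0; have /eqP := oner_neq0 B; apply.
  by apply: (regs 1 0); rewrite s0 !mul0r.
have regP (s : B) : s != 0 -> regular s.
  move=> s0; split=> x y E; apply/subr0_eq/eqP; apply: contraT => xy0.
    by have := domB _ _ s0 xy0; rewrite mulrBr E subrr eqxx.
  by have := domB _ _ xy0 s0; rewrite mulrBl E subrr eqxx.
have lu x : (l x \is a GRing.unit) = (x != 0).
  by rewrite ofrac_unitE ofrac_in_eq0 phi_eq0.
have lV w : w != 0 -> ofrac_in (weyl_ore W) w \is a GRing.unit.
  by rewrite ofrac_unitE ofrac_in_eq0.
have lM x y : ofrac_in (weyl_ore W) (x * y) =
    ofrac_in (weyl_ore W) x * ofrac_in (weyl_ore W) y by exact: rmorphM.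
have p0 h : h != 0 -> wpoly h != 0 by rewrite wpoly_eq0.
split.
- by move=> s /reg0; rewrite lu.
- move=> q; have [w [v [v0 ->]]] := ofrac_right q.
  have [h [h0 [r Er]]] := weyl_right_denominator w.
  have [h' [h'0 [s Es]]] := weyl_right_denominator v.
  have n0 : wpoly (h * h') != 0 by rewrite p0 ?mulf_neq0.
  have E1 : w * wpoly (h * h') = phi (r * horner_alg c h').
    by rewrite rmorphM mulrA Er rmorphM /= horner_alg_map phic wpoly_horner.
  have E2 : v * wpoly (h * h') = phi (s * horner_alg c h).
    by rewrite [h * h']mulrC rmorphM mulrA Es rmorphM /= horner_alg_map phic wpoly_horner.
  exists (r * horner_alg c h'), (s * horner_alg c h); split.
    by apply: regP; rewrite -phi_eq0 -E2 domW.
  by rewrite /l /= -E1 -E2 !lM invrM ?lV // [RHS]mulrA mulrK ?lV.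
- move=> q; have [w [v [v0 ->]]] := ofrac_left q.
  have [h [h0 [r Er]]] := weyl_left_denominator w.
  have [h' [h'0 [s Es]]] := weyl_left_denominator v.
  have n0 : wpoly (h * h') != 0 by rewrite p0 ?mulf_neq0.
  have E1 : wpoly (h * h') * w = phi (horner_alg c h' * r).
    by rewrite [h * h']mulrC rmorphM -mulrA Er rmorphM /= horner_alg_map phic wpoly_horner.
  have E2 : wpoly (h * h') * v = phi (horner_alg c h * s).
    by rewrite rmorphM -mulrA Es rmorphM /= horner_alg_map phic wpoly_horner.
  exists (horner_alg c h' * r), (horner_alg c h * s); split.
    by apply: regP; rewrite -phi_eq0 -E2 domW.
  by rewrite /l /= -E1 -E2 !lM invrM ?lV // -[RHS]mulrA mulKr ?lV.
- move=> r; split=> [lr|[s /reg0 s0 rs0]].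
    exists 1; first by apply: regP; apply: oner_neq0.
    by rewrite mulr1; apply/eqP; move/eqP: lr; rewrite ofrac_in_eq0 phi_eq0.
  suff -> : r = 0 by rewrite rmorph0.
  by apply/eqP; apply: contraT => r0; have := domB _ _ r0 s0; rewrite rs0 eqxx.
- move=> r; split=> [lr|[s /reg0 s0 rs0]].
    exists 1; first by apply: regP; apply: oner_neq0.
    by rewrite mul1r; apply/eqP; move/eqP: lr; rewrite ofrac_in_eq0 phi_eq0.
  suff -> : r = 0 by rewrite rmorph0.
  by apply/eqP; apply: contraT => r0; have := domB _ _ s0 r0; rewrite rs0 eqxx.
Qed.
End Fractions.
End WeylAlgebra.

(** * Universal property of a skew polynomial ring *)

Lemma lrmorphism_of (k : fieldType) (A B : algType k) (F : A -> B) :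
  linear F -> F 1 = 1 -> (forall x y, F (x * y) = F x * F y) ->
  exists Phi : {lrmorphism A -> B}, Phi =1 F.
Proof.
move=> linF F1 FM.
pose Phi : {lrmorphism A -> B} := HB.pack F
  (GRing.isLinear.Build k A B *:%R F linF)
  (GRing.isMonoidMorphism.Build A B F (F1, FM)).
by exists Phi.
Qed.

Section SkewPolynomialRing.
Variables (k : fieldType) (R M : algType k).
Variables (sigma : {lrmorphism R -> R}) (delta : {linear R -> R}).
Variables (j : {lrmorphism R -> M}) (b : M).
Hypothesis skewM : skew_polynomial_ring sigma delta j b.

Lemma skew_ring_ev (q : {poly R}) r :
  (map_poly j (q * 'X + r%:P)).[b] = (map_poly j q).[b] * b + j r.
Proof. by rewrite rmorphD rmorphM /= map_polyX map_polyC hornerD hornerMX hornerC. Qed.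

Lemma skew_ring_coef_inj r s r' s' :
  j r * b + j s = j r' * b + j s' -> r = r' /\ s = s'.
Proof.
case: skewM => _ _ _ /bij_inj inj E.
have ev r1 s1 : (map_poly j (r1%:P * 'X + s1%:P)).[b] = j r1 * b + j s1.
  by rewrite skew_ring_ev map_polyC hornerC.
have /polyP Ep : r%:P * 'X + s%:P = r'%:P * 'X + s'%:P by apply: inj; rewrite !ev.
split; [have := Ep 1 | have := Ep 0].
  by rewrite !coefD !coefMX !coefC /= !addr0.
by rewrite !coefD !coefMX !coefC /= !add0r.
Qed.

Lemma skew_ring_span x : horner_span (fun y => exists r, y = j r) b x.
Proof.
case: skewM => _ _ _ [ev' _ evK]; rewrite -[x]evK.
elim/poly_ind: (ev' x) => [|q r IH]; first by rewrite rmorph0 horner0; constructor.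
by rewrite skew_ring_ev; constructor=> //; exists r.
Qed.

Lemma skew_der1 : delta 1 = 0.
Proof.
case: skewM => _ dM _ _; apply: (addIr (delta 1)).
by rewrite add0r -{3}[1]mulr1 dM rmorph1 mul1r mulr1.
Qed.

Section Lift.
Variables (B : algType k) (phi : {lrmorphism R -> B}) (beta : B).
Hypothesis comm : forall r, beta * phi r = phi (sigma r) * beta + phi (delta r).

(** R[b; sigma, delta] is universal for its commutation rule: the map that
    evaluates left coefficients is multiplicative because this can be checked
    on b and on R separately. *)
Lemma skew_ring_lift : exists Phi : {lrmorphism M -> B},
  (forall r, Phi (j r) = phi r) /\ Phi b = beta.
Proof.
case: skewM => _ dM jb [coefs coefsK evK].
pose Phi x := (map_poly phi (coefs x)).[beta].
have PhiS x r : Phi (x * b + j r) = Phi x * beta + phi r.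
  have -> : x * b + j r = (map_poly j (coefs x * 'X + r%:P)).[b].
    by rewrite skew_ring_ev evK.
  rewrite /Phi coefsK rmorphD rmorphM /= map_polyX map_polyC hornerD hornerMX.
  by rewrite hornerC.
have PhiD x y : Phi (x + y) = Phi x + Phi y.
  rewrite /Phi -hornerD -rmorphD /=; congr (_.[_]); congr map_poly.
  by apply: (can_inj coefsK); rewrite evK rmorphD hornerD !evK.
have Phi0 : Phi 0 = 0 by apply: (addIr (Phi 0)); rewrite -PhiD !add0r.
have Phij r : Phi (j r) = phi r.
  by have := PhiS 0 r; rewrite !mul0r !add0r Phi0 mul0r add0r.
have Phib x : Phi (x * b) = Phi x * beta.
  by have := PhiS x 0; rewrite !rmorph0 !addr0.
have Phijl r y : Phi (j r * y) = phi r * Phi y.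
  elim: (skew_ring_span y) => [|{}y _ _ IH [s ->]]; first by rewrite mulr0 Phi0 mulr0.
  by rewrite mulrDr mulrA -rmorphM !PhiS IH mulrDr -mulrA rmorphM.
have Phibl y : Phi (b * y) = beta * Phi y.
  elim: (skew_ring_span y) => [|{}y _ _ IH [s ->]]; first by rewrite mulr0 Phi0 mulr0.
  by rewrite mulrDr mulrA PhiD Phib IH jb !PhiS Phij mulrDr mulrA comm.
have [] := @lrmorphism_of _ _ _ Phi.
- move=> a x y; rewrite PhiD; congr (_ + _).
  by rewrite -mulr_algl -(rmorph1 j) -linearZ Phijl linearZ rmorph1 mulr_algl.
- by rewrite -(rmorph1 j) Phij rmorph1.
- move=> x y; elim: (skew_ring_span x) y => [|{}x _ _ IH [r ->]] y.
    by rewrite mul0r Phi0 mul0r.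
  by rewrite mulrDl PhiD -mulrA IH Phibl Phijl PhiS mulrDl mulrA.
move=> Psi E; exists Psi; split=> [r|]; first by rewrite E Phij.
by rewrite E -[b]mul1r Phib -(rmorph1 j) Phij rmorph1 mul1r.
Qed.
End Lift.
End SkewPolynomialRing.

(** * Solving the relations of M_J(2) *)

(** In an algebra where c is left regular and t is central, the relations of
    P(c^2,c) and the equation c b = t + (a - c) d for b imply all relations of
    M_J(2).  The element (a - c) d is determined up to central terms by the
    requirement that c b minus it be central. *)
Section JordanianRelations.
Variables (k : fieldType) (A : algType k) (a b c d t : A).
Hypotheses (ac : a * c = c * a + c * c) (dc : d * c = c * d + c * c).
Hypothesis da : d * a = (a - c) * d + c * a.
Hypothesis cb : c * b = t + (a - c) * d.
Hypothesis t_central : forall x, t * x = x * t.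
Hypothesis c_reg : GRing.lreg c.

Let acC : (a - c) * c = c * a. Proof. by rewrite mulrBl ac addrK. Qed.

Lemma jordanian_relations : MJ2_relations a b c d.
Proof.
split; first by rewrite expr2.
- apply: c_reg; rewrite !expr2.
  have -> : c * (b * c) = c * t + (c * a * d + (c * c * a + c * c * c)).
    rewrite mulrA cb mulrDl t_central -mulrA dc mulrDr !mulrA acC.
    by rewrite -[c * a * c]mulrA ac mulrDr !mulrA.
  have -> : c * (c * b + c * a + c * d + c * c) =
      c * t + (c * a * d - c * c * d) + c * c * a + c * c * d + c * c * c.
    by rewrite !mulrDr cb mulrDr !mulrA mulrBr mulrBl.
  rewrite -!addrA; congr (_ + (_ + _)).
  by rewrite [c * c * a + (_ + _)]addrCA addKr.
split; first by rewrite expr2.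
- apply: c_reg; rewrite !expr2.
  have -> : c * (b * d) = d * t + (a - c) * d * d.
    by rewrite mulrA cb mulrDl t_central.
  have dE : d * ((a - c) * d) =
      (a - c) * d * d + c * a * d - (c * d * d + c * c * d).
    rewrite mulrA mulrBr da dc mulrBl [(_ + c * a) * d]mulrDl.
    by rewrite [(c * d + _) * d]mulrDl.
  have -> : c * (d * b + c * b + c * d - a * d + d * d) =
      d * t + ((a - c) * d * d + c * a * d - (c * d * d + c * c * d))
      + c * c * d - c * a * d + c * d * d.
    rewrite !mulrDr mulrN !mulrA -[_ + c * c * b]mulrDl -dc -[d * c * b]mulrA cb.
    by rewrite mulrDr dE.
  rewrite -!addrA; congr (_ + _); rewrite -[LHS]addr0; congr (_ + _).
  by rewrite opprD -[(- _ - _) + _]addrA addKr [- (c * d * d) + _]addrCA addNr addr0 subrr.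
- by rewrite da mulrBl addrAC.
- apply: c_reg; rewrite !expr2.
  have -> : c * (b * a) = a * t + ((a - c) * ((a - c) * d) + c * a * a).
    rewrite mulrA cb mulrDl t_central -mulrA da mulrDr.
    by rewrite [(a - c) * (c * a)]mulrA acC.
  have -> : c * (a * b + c * b + c * d - a * d + a * a) =
      a * t + a * ((a - c) * d) + c * c * d - c * a * d + c * a * a.
    rewrite !mulrDr mulrN !mulrA -[_ + c * c * b]mulrDl -ac -[a * c * b]mulrA cb.
    by rewrite mulrDr !mulrA.
  rewrite [(a - c) * (_ * d)]mulrBl [c * (_ * d)]mulrA mulrBr [X in _ - X]mulrBl.
  by rewrite opprB !addrA.
Qed.
End JordanianRelations.

(** * Embeddings into k(c)[y; d/dc][s,t] *)

Section Embeddings.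
Variables (k : fieldType) (W : weyl_structure k).
Local Notation wcoef := (wcoef W).
Local Notation wt := (wt W).
Local Notation wpoly := (wpoly W).

Definition winv (p : {poly k}) : W := wcoef (tofun p)^-1.

Lemma winvK p : p != 0 -> winv p * wpoly p = 1.
Proof.
by move=> p0; rewrite -rmorphM mulVf ?rmorph1 ?tofun_eq0.
Qed.
Lemma wpolyK p : p != 0 -> wpoly p * winv p = 1.
Proof.
by move=> p0; rewrite -[wpoly p]/(wcoef (tofun p)) -rmorphM mulfV ?rmorph1 ?tofun_eq0.
Qed.

Definition has_weyl_fractions (B : algType k) :=
  exists l : {lrmorphism B -> ofrac (weyl_ore W)}, classical_quotient_ring l.

Lemma birational_of_weyl_fractions (A B : algType k) :
  has_weyl_fractions A -> has_weyl_fractions B -> birationally_equivalent A B.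
Proof.
move=> [lA QA] [lB QB]; exists _, _, lA, lB; split=> //.
by exists (idfun : {lrmorphism _ -> _}); exists id.
Qed.

Lemma weyl2_wa f : @weyl2 k W (wa W f).
Proof.
apply: (subalgM (weyl2_sub W)); apply: weyl2_1; first exact: weyl1_coef.
exact: weyl1_y.
Qed.
Lemma weyl2_wpoly h : @weyl2 k W (wpoly h).
Proof. exact/weyl2_1/weyl1_coef. Qed.
Lemma weyl2_wu : @weyl2 k W (wu W).
Proof. by apply: (subalgM (weyl2_sub W)); [apply: weyl2_wpoly | apply: weyl2_s]. Qed.

(** M_J(2) is spanned by the c^i a^j u^m b^n because b x lies in T b + T for
    every x in the subalgebra T generated by a, c and d; it suffices to see
    this for the three generators. *)
Lemma MJ2_weyl_fractions (MJ : algType k) (a b c d : MJ) :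
  is_MJ2 a b c d -> has_weyl_fractions MJ.
Proof.
move=> isMJ; have [[r1 r2 [r3 r4 r5 r6]] univ _] := isMJ.
pose a' := wa W 'X^2; pose c' := wc W; pose d' := a' + wu W.
have [] := @weyl_P_relations _ W 'X^2 'X (expr2 _).
rewrite !wpoly_horner -/a' -/c' -/d' => ac' dc' da'.
have c2 : wpoly 'X^2 = c' * c' by rewrite expr2 rmorphM.
rewrite {}c2 in ac' dc'.
have X0 : 'X != 0 :> {poly k} by rewrite polyX_eq0.
pose b' := winv 'X * (wt + (a' - c') * d').
have cb' : c' * b' = wt + (a' - c') * d' by rewrite mulrA wpolyK // mul1r.
have regc : GRing.lreg c'.
  by move=> x y E; rewrite -[x]mul1r -[y]mul1r -(winvK X0) -!mulrA; congr (_ * _).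
have rels' := jordanian_relations ac' dc' da' cb' (@wt_central k W) regc.
have [phi [phia phib phic phid]] := univ W a' b' c' d' rels'.
have phiu : phi (d - a) = wu W by rewrite rmorphB /= phia phid addrC addKr.
have rels : P_relations 'X^2 'X a c d.
  split; rewrite ?rmorphXn /= ?horner_algX ?expr2 -?expr2 //.
  by rewrite r5 mulrBl addrAC.
have S3 := cau_span_subalgebra rels.
have memM x y : cau_span a c d x -> cau_span a c d y -> cau_span a c d (x * y).
  exact: (subalgM S3).
have memD x y : cau_span a c d x -> cau_span a c d y -> cau_span a c d (x + y).
  exact: (subalgD S3).
have memN x : cau_span a c d x -> cau_span a c d (- x).
  by move=> Tx; rewrite -scaleN1r; apply: (subalgZ S3).
have [mema memc memd] := And3 (cau_span_a a c d) (cau_span_c a c d) (cau_span_d rels).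
(* X x says that b can be moved to the right of x. *)
pose X x := cau_span a c d x /\ exists t1 t2,
  [/\ cau_span a c d t1, cau_span a c d t2 & b * x = t1 * b + t2].
have subX : subalgebra X.
  split.
  - split; first exact: (subalg1 S3).
    exists 1, 0; rewrite mulr1 mul1r addr0; split=> //.
      by apply: (subalg1 S3).
    by apply: (subalg0 S3).
  - move=> x y [Tx [x1 [x2 [? ? Ex]]]] [Ty [y1 [y2 [? ? Ey]]]]; split; first exact: memD.
    exists (x1 + y1), (x2 + y2); split; [exact: memD | exact: memD | ].
    by rewrite mulrDr Ex Ey mulrDl addrACA.
  - move=> x y [Tx [x1 [x2 [? ? Ex]]]] [Ty [y1 [y2 [? ? Ey]]]]; split; first exact: memM.
    exists (x1 * y1), (x1 * y2 + x2 * y); split.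
    + exact: memM.
    + by apply: memD; apply: memM.
    + by rewrite mulrA Ex mulrDl -[x1 * b * y]mulrA Ey mulrDr !mulrA addrA.
  - move=> r x [Tx [x1 [x2 [? ? Ex]]]]; split; first exact: (subalgZ S3).
    exists (r *: x1), (r *: x2); split; [exact: (subalgZ S3) | exact: (subalgZ S3) | ].
    by rewrite -scalerAr Ex scalerDr scalerAl.
have TX x : cau_span a c d x -> X x.
  apply: (cau_span_min subX); split=> //.
  - exists (a + c), (c * d - a * d + a ^+ 2); rewrite expr2; split.
    + by repeat first [assumption | apply: (memD)].
    + by repeat first [assumption | apply: (memD) | apply: (memM) | apply: (memN)].
    + by rewrite r6 expr2 mulrDl !addrA.
  - exists c, (c * a + c * d + c ^+ 2); rewrite expr2; split=> //.
    + by repeat first [assumption | apply: (memD) | apply: (memM) | apply: (memN)].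
    + by rewrite r2 expr2 !addrA.
  - exists (d + c), (c * d - a * d + d ^+ 2); rewrite expr2; split.
    + by repeat first [assumption | apply: (memD)].
    + by repeat first [assumption | apply: (memD) | apply: (memM) | apply: (memN)].
    + by rewrite r4 expr2 mulrDl !addrA.
have S4 : subalgebra (horner_span (cau_span a c d) b).
  by apply: (span_subalgebra S3) => x /TX[].
have all4 x : horner_span (cau_span a c d) b x.
  apply: (MJ2_gen isMJ S4); first exact: span_base; last first.
  - exact: span_base.
  - exact: span_base.
  - exact: span_var.
have f0 : 'X^2 != 0 :> {poly k} by rewrite expf_neq0.
have inj x : phi x = 0 -> x = 0.
  apply: (@horner_span_faithful _ W _ phi b (tofun 'X)^-1 (winv 'X * ((a' - c') * d'))).
  - by rewrite invr_eq0 tofun_eq0.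
  - apply: (subalgM (weyl2_sub W)); first exact/weyl2_1/weyl1_coef.
    apply: (subalgM (weyl2_sub W)).
      apply: (subalgD (weyl2_sub W)); first exact: weyl2_wa.
      by rewrite -rmorphN; apply: weyl2_wpoly.
    by apply: (subalgD (weyl2_sub W)); [apply: weyl2_wa | apply: weyl2_wu].
  - by rewrite phib /b' mulrDr.
  - by move=> y; apply: (cau_span_faithful f0 phia phic phiu).
  - exact: all4.
eexists; apply: (@weyl_quotient_ring _ W 'X^2 MJ a c (d - a)
  (c * b - (a - c) * d) phi f0 phia phic phiu _ inj).
by rewrite !(rmorphB, rmorphM) /= phia phib phic phid cb' addrK.
Qed.

Section GeneralizedJordanian.
Variables (f g : {poly k}) (P : algType k) (a c d : P).
Hypotheses (f0 : f != 0) (hfg : f = 'X * g) (isP : is_P f g a c d).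

Lemma P_weyl_embedding : exists phi : {lrmorphism P -> W},
  [/\ phi a = wa W f, phi c = wc W, phi (d - a) = wu W
    & forall x, @weyl2 k W (phi x) /\ (phi x = 0 -> x = 0)].
Proof.
have [_ univ _] := isP.
have [phi [phia phic phid]] := univ W _ _ _ (weyl_P_relations W hfg).
have phiu : phi (d - a) = wu W by rewrite rmorphB /= phia phid addrC addKr.
exists phi; split=> // x.
exact: (cau_span_faithful f0 phia phic phiu (is_P_span isP x)).
Qed.

Lemma P_lreg (x : P) : x != 0 -> GRing.lreg x.
Proof.
have [phi [_ _ _ phiP]] := P_weyl_embedding.
move=> x0 y z E; apply/subr0_eq; apply: (phiP _).2.
have : phi x * phi (y - z) = 0 by rewrite -rmorphM mulrBr E subrr rmorph0.
move/eqP; apply: contraTeq => yz0; have [domW _ _] := weyl_ore W.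
by apply: domW => //; apply: contraNneq x0 => /(phiP x).2 ->.
Qed.

Variables (p : {poly k}) (p0 : p != 0).
Local Notation pc := (horner_alg c p).

Lemma P_pc_neq0 : pc != 0.
Proof.
have [phi [_ phic _ _]] := P_weyl_embedding.
apply: contra_neq p0 => /(congr1 phi)/eqP.
by rewrite rmorph0 horner_alg_map phic wpoly_horner wpoly_eq0 => /eqP.
Qed.

(** The equation sigma(x) = p^-1 x p, cleared of its denominator.  The
    localization map kills only p-torsion, and P has none since it embeds in
    the domain W. *)
Lemma conj_of_localization (Pp : unitAlgType k) (l : {lrmorphism P -> Pp}) (x y : P) :
  Ore_localization (powers pc) l -> l y = (l pc)^-1 * l x * l pc ->
  pc * y = x * pc.
Proof.
case=> lunit _ _ ker _ Ey; apply/subr0_eq.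
have lp : l pc \is a GRing.unit by apply: lunit; exists 1.
have /ker[s [n ->]] : l (pc * y - x * pc) = 0.
  by rewrite rmorphB !rmorphM /= Ey !mulrA mulrV // mul1r subrr.
have [phi [_ _ _ phiP]] := P_weyl_embedding => E.
apply: (phiP _).2; apply/eqP; apply: contraT => nz.
have [domW _ _] := weyl_ore W.
have : phi ((pc * y - x * pc) * pc ^+ n) != 0.
  rewrite rmorphM domW // rmorphXn.
  have : phi pc != 0 by apply: contra_neq P_pc_neq0 => /(phiP _).2.
  by move=> nzp; elim: n {E} => [|n IH]; rewrite ?expr0 ?oner_neq0 // exprS domW.
by rewrite E rmorph0 eqxx.
Qed.

Variables (theta : P) (sigma : {lrmorphism P -> P}) (delta : {linear P -> P}).
Hypothesis sigmaE : forall x, x \in [:: a; d - a; c] -> pc * sigma x = x * pc.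
Hypothesis deltaE :
  forall x, x \in [:: a; d - a; c] -> delta x = theta * x - sigma x * theta.
Variables (G : algType k) (j : {lrmorphism P -> G}) (b : G).
Hypothesis skewG : skew_polynomial_ring sigma delta j b.

(** The image of b is p^-1 t + theta, so that t = p (b - theta). *)
Lemma skew_weyl_fractions : has_weyl_fractions G.
Proof.
have [phi [phia phic phiu phiP]] := P_weyl_embedding.
have phip : phi pc = wpoly p by rewrite horner_alg_map phic wpoly_horner.
pose beta := winv p * wt + phi theta.
have [_ dM _ _] := skewG.
pose S r := beta * phi r = phi (sigma r) * beta + phi (delta r).
have subS : subalgebra S.
  split; rewrite /S.
  - by rewrite (skew_der1 skewG) !rmorph1 mulr1 mul1r rmorph0 addr0.
  - by move=> x y Ex Ey; rewrite !raddfD /= mulrDr Ex Ey mulrDl addrACA.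
  - move=> x y Ex Ey; rewrite !rmorphM dM mulrA Ex mulrDl -mulrA Ey mulrDr rmorphD.
    by rewrite !rmorphM !mulrA addrA.
  - by move=> r x Ex; rewrite !linearZ /= -scalerAr Ex scalerDr scalerAl.
have Sgen x : x \in [:: a; d - a; c] -> S x.
  move=> gx; rewrite /S (deltaE gx) rmorphB !rmorphM /=.
  have key : phi (sigma x) * winv p = winv p * phi x.
    have := congr1 phi (sigmaE gx); rewrite !rmorphM /= phip => E.
    by rewrite -[phi (sigma x)]mul1r -(winvK p0) -[winv p * _ * _]mulrA E
      -!mulrA wpolyK // mulr1.
  rewrite /beta mulrDl mulrDr [phi (sigma x) * _]mulrA key -!mulrA wt_central.
  by rewrite -addrA [_ * phi theta + _]addrCA subrr addr0.
have subD x y : S x -> S y -> S (x + y) by exact: (subalgD subS).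
have allS x : S x.
  apply: (P_gen isP subS).
  - by apply: Sgen; rewrite !inE eqxx.
  - by apply: Sgen; rewrite !inE eqxx !orbT.
  - by rewrite -(subrK a d); apply: subD; apply: Sgen; rewrite !inE eqxx ?orbT.
have [Phi [Phij Phib]] := skew_ring_lift skewG allS.
have inj x : Phi x = 0 -> x = 0.
  apply: (@horner_span_faithful _ W _ Phi b (tofun p)^-1 (phi theta)
    (fun y => exists r, y = j r)).
  - by rewrite invr_eq0 tofun_eq0.
  - exact: (phiP theta).1.
  - exact: Phib.
  - move=> _ [r ->]; rewrite Phij; split; first exact: (phiP r).1.
    by move/(phiP r).2 => ->; rewrite rmorph0.
  - exact: (skew_ring_span skewG).
eexists; apply: (@weyl_quotient_ring _ W f G (j a) (j c) (j (d - a))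
  (j pc * (b - j theta)) Phi f0 _ _ _ _ inj); rewrite ?Phij //.
rewrite rmorphM rmorphB /= !Phij Phib phip /beta addrK mulrA wpolyK //.
by rewrite mul1r.
Qed.
End GeneralizedJordanian.
End Embeddings.

(** * Extending the involution *)

Section Involution.
Variables (k : fieldType) (R M : algType k).
Variables (tau sigma : {lrmorphism R -> R}) (delta : {linear R -> R}).
Variables (j : {lrmorphism R -> M}) (b : M).
Hypothesis skewM : skew_polynomial_ring sigma delta j b.

(** Apply t to b r = sigma(r) b + delta(r) and compare coefficients. *)
Lemma extension_commutes (t : {lrmorphism M -> M}) :
  (forall x, t (j x) = j (tau x)) -> t b = b ->
  forall r, sigma (tau r) = tau (sigma r) /\ delta (tau r) = tau (delta r).
Proof.
case: (skewM) => _ _ jb _ tj tb r; apply: (skew_ring_coef_inj skewM).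
by rewrite -jb -!tj -{1}tb -rmorphM jb rmorphD rmorphM /= tb.
Qed.

Lemma involution_extends : involutive tau ->
  (forall r, sigma (tau r) = tau (sigma r)) ->
  (forall r, delta (tau r) = tau (delta r)) ->
  exists t : {lrmorphism M -> M},
    [/\ bijective t, forall x, t (j x) = j (tau x) & t b = b].
Proof.
move=> tauK st dt; have [_ _ jb _] := skewM.
have comm r : b * (j \o tau) r = (j \o tau) (sigma r) * b + (j \o tau) (delta r).
  by rewrite /= jb st dt.
have [t [tj tb]] := skew_ring_lift skewM comm.
have {}tj r : t (j r) = j (tau r) := tj r.
exists t; split=> //; exists t => x; move: (skew_ring_span skewM x);
  by elim=> [|{}x _ _ IH [r ->]]; rewrite ?rmorph0 // !(rmorphD, rmorphM) /= IH
    !tj tauK !tb.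
Qed.
End Involution.

Theorem proposition7p6 (k : closedFieldType) (hk : [pchar k] =i pred0)
    (f g : {poly k}) (hf : (1 < size f)%N) (hfg : f = 'X * g)
    (P : algType k) (a c d : P) (hP : is_P f g a c d)
    (tau : {lrmorphism P -> P})
    (htau : [/\ tau a = d, tau d = a & tau c = c])
    (p : {poly k}) (hp : irreducible_poly p) (hpf : p %| f)
    (Pp : unitAlgType k) (l : {lrmorphism P -> Pp})
    (hl : Ore_localization (powers (horner_alg c p)) l)
    (theta : P)
    (sigma : {lrmorphism P -> P})
    (hsigma : forall x, x \in [:: a; d - a; c] ->
       l (sigma x) = (l (horner_alg c p))^-1 * l x * l (horner_alg c p))
    (delta : {linear P -> P})
    (hdelta : forall x, x \in [:: a; d - a; c] ->
       delta x = theta * x - sigma x * theta)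
    (G : algType k) (j : {lrmorphism P -> G}) (b : G)
    (hG : skew_polynomial_ring sigma delta j b)
    (MJ : algType k) (aJ bJ cJ dJ : MJ) (hMJ : is_MJ2 aJ bJ cJ dJ) :
  GJMA MJ tau sigma delta j b <->
  (delta (d - a) = tau (delta a) - delta a /\ delta c = tau (delta c)).
Proof.
case: htau => tau_a tau_d tau_c.
split=> [[_ _ [t [_ tj tb]]] | [du dc]].
  have comm r := (extension_commutes hG tj tb r).2.
  by rewrite raddfB /= -comm tau_a -comm tau_c.
have f0 : f != 0 by rewrite -size_poly_gt0 (ltn_trans _ hf).
have p0 : p != 0 by rewrite -size_poly_gt0 (ltn_trans _ hp.1).
have [W] := weyl_exists k.
set pc := horner_alg c p in hl hsigma.
have sigmaE x : x \in [:: a; d - a; c] -> pc * sigma x = x * pc.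
  by move/hsigma; apply: (conj_of_localization W f0 hfg hP p0 hl).
split=> //.
  apply: (birational_of_weyl_fractions (W := W)).
    exact: (skew_weyl_fractions W f0 hfg hP p0 sigmaE hdelta hG).
  exact: MJ2_weyl_fractions hMJ.
have gen (S : P -> Prop) := P_gen hP (S := S).
have tauK : involutive tau.
  have [_ _ uniq] := hP; move=> x; pose e : {lrmorphism P -> P} := tau \o tau.
  by apply: (uniq _ e (idfun : {lrmorphism P -> P})); rewrite /e /= ?tau_a ?tau_d ?tau_c
    ?tau_a ?tau_d ?tau_c.
have sigma_a : pc * sigma a = a * pc by apply: sigmaE; rewrite !inE eqxx.
have sigma_c : pc * sigma c = c * pc by apply: sigmaE; rewrite !inE eqxx !orbT.
have sigma_d : pc * sigma d = d * pc.
  rewrite -(subrK a d) raddfD /= mulrDr mulrDl sigma_a sigmaE //.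
  by rewrite !inE eqxx !orbT.
have tau_pc : tau pc = pc by rewrite horner_alg_map tau_c.
have regpc : GRing.lreg pc := P_lreg W f0 hfg hP (P_pc_neq0 W f0 hfg hP p0).
(* After multiplication by p(c), both sides are tau(x) p(c). *)
have st_gen x : pc * sigma x = x * pc -> pc * sigma (tau x) = tau x * pc ->
    sigma (tau x) = tau (sigma x).
  move=> Ex Et; apply: regpc; rewrite /= Et.
  by rewrite -{1}tau_pc -rmorphM -Ex rmorphM /= tau_pc.
have st : forall r, sigma (tau r) = tau (sigma r).
  apply: gen; last 3 first.
  - by apply: st_gen => //; rewrite tau_a.
  - by apply: st_gen => //; rewrite tau_c.
  - by apply: st_gen => //; rewrite tau_d.
  split; first by rewrite !rmorph1.
  - by move=> x y Ex Ey; rewrite !rmorphD /= Ex Ey.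
  - by move=> x y Ex Ey; rewrite !rmorphM /= Ex Ey.
  - by move=> r x Ex; rewrite !linearZ /= Ex.
have dd : delta d = tau (delta a) by rewrite -(subrK a d) raddfD /= du subrK.
have dt : forall r, delta (tau r) = tau (delta r).
  have [_ dM _ _] := hG.
  apply: gen; last 3 first.
  - by rewrite tau_a.
  - by rewrite tau_c.
  - by rewrite tau_d dd tauK.
  split; first by rewrite rmorph1 (skew_der1 hG) rmorph0.
  - by move=> x y Ex Ey; rewrite !raddfD /= Ex Ey.
  - by move=> x y Ex Ey; rewrite rmorphM !dM rmorphD !rmorphM /= Ex Ey st.
  - by move=> r x Ex; rewrite !linearZ /= Ex.
exact: (involution_extends hG tauK st dt).
Qed.
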